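(* Let $N\geq 2$, $k\in\mathbb{R}$, $\sigma\in\mathbb{R}$. Assume that $f\in L^1(\partial B_1)$ and $I_f:=\int_{\partial B_1} f(x)\,dS_x>0$. If $-1\leq\alpha\leq 0$ and $k\leq 2-N$, then for all $p>1$: (i) the problem consisting of the inequality $\partial_t u-\Delta u-k\frac{x}{|x|^2}\cdot\nabla u\geq t^\alpha|x|^\sigma|u|^p$ in $(0,\infty)\times B_1^c$ under the Neumann-type boundary condition $\frac{\partial u}{\partial\nu}(t,x)\geq f(x)$ on $(0,\infty)\times\partial B_1$ admits no global weak solution for $\sigma+2(\alpha+1)>2-N-k$; (ii) the problem consisting of the same inequality under the Dirichlet-type boundary condition $u(t,x)\geq f(x)$ on $(0,\infty)\times\partial B_1$ admits no global weak solution for $\sigma+2(\alpha+1)>0$.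
   Context: $B_1$ is the open unit ball centered at the origin of $\mathbb{R}^N$, $B_1^c$ is its complement in $\mathbb{R}^N$ (a closed set), $\nu$ is the outward unit normal on $\partial B_1$ relative to $B_1^c$ (so $\nu(x)=-x$). Put $\Omega=(0,\infty)\times B_1^c$ and $\Gamma=(0,\infty)\times\partial B_1$; note $\Gamma\subset\Omega$. Solutions are real-valued and may change sign. The notation $\mathrm{supp}(\varphi)\subset\subset\Omega$ means that the support is a compact subset of $\Omega$ (it may meet $\Gamma$). $C^{1,2}_{t,x}(\Omega)$ denotes functions that are $C^1$ in $t$ and $C^2$ in $x$ on $\Omega$. Neumann-type problem. Let $\Phi=\{\varphi\in C^{1,2}_{t,x}(\Omega):\ \varphi\geq 0,\ \mathrm{supp}(\varphi)\subset\subset\Omega,\ (\frac{\partial\varphi}{\partial\nu}+k\varphi)|_\Gamma=0\}$. A global weak solution of the inequality under the Neumann-type boundary condition is a function $u\in L^p_{loc}(\Omega)$ such that for every $\varphi\in\Phi$, $$\int_\Omega t^\alpha|x|^\sigma|u|^p\varphi\,dx\,dt+\int_\Gamma f\varphi\,dS_x\,dt\leq-\int_\Omega u\,\partial_t\varphi\,dx\,dt+\int_\Omega\left(-\Delta\varphi+k\,\mathrm{div}\left(\varphi\frac{x}{|x|^2}\right)\right)u\,dx\,dt.$$ Dirichlet-type problem. Let $\Psi=\{\psi\in C^{1,2}_{t,x}(\Omega):\ \psi\geq 0,\ \mathrm{supp}(\psi)\subset\subset\Omega,\ \psi|_\Gamma=0,\ \frac{\partial\psi}{\partial\nu}|_\Gamma\leq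 0\}$. A global weak solution of the inequality under the Dirichlet-type boundary condition is a function $u\in L^p_{loc}(\Omega)$ such that for every $\psi\in\Psi$, $$\int_\Omega t^\alpha|x|^\sigma|u|^p\psi\,dx\,dt-\int_\Gamma f\frac{\partial\psi}{\partial\nu}\,dS_x\,dt\leq-\int_\Omega u\,\partial_t\psi\,dx\,dt+\int_\Omega\left(-\Delta\psi+k\,\mathrm{div}\left(\psi\frac{x}{|x|^2}\right)\right)u\,dx\,dt.$$ *)

(* Defs.v *)
From HB Require Import structures.
From mathcomp Require Import all_boot all_order all_algebra.
From mathcomp Require Import all_classical all_reals all_analysis.
From mathcomp Require Import measurable_realfun.

Set Implicit Arguments.
Unset Strict Implicit.
Unset Printing Implicit Defensive.

Import Order.TTheory GRing.Theory Num.Theory.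
Import numFieldNormedType.Exports.

Local Open Scope classical_set_scope.
Local Open Scope ring_scope.

(** Borel sigma-algebra and Lebesgue measure on ['rV[R]_n], built like those of
    [n.-tuple R]: the sigma-algebra is generated by the coordinates. *)

Definition rV_display : measure_display.
Proof. exact: default_measure_display. Qed.

Section rV_measurable.
Context (R : realType) (n : nat).

Definition rV_coord (i : 'I_n) (x : 'rV[R]_n) : R := x ord0 i.

HB.instance Definition _ := @isMeasurable.Build rV_display
  'rV[R]_n (g_sigma_preimage rV_coord)
  (@sigma_algebra0 _ setT _) (@sigma_algebraC _ _) (@sigma_algebra_bigcup _ _ _).

End rV_measurable.

Section rV_measurable_fun.
Context (R : realType) (n : nat).

Lemma measurable_rV_coord (i : 'I_n) : measurable_fun setT (@rV_coord R n i).
Proof.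
move=> _ Y mY; rewrite setTI; apply: sub_sigma_algebra => /=.
rewrite -bigcup_seq/=; exists i => /=; first by rewrite mem_index_enum.
by exists Y => //; rewrite setTI.
Qed.

Lemma measurable_fun_rV d (T : measurableType d) (f : T -> 'rV[R]_n) :
  (forall i, measurable_fun setT (fun x => f x ord0 i)) -> measurable_fun setT f.
Proof.
move=> mf.
suff : g_sigma_preimage (fun i => @rV_coord R n i \o f) `<=` measurable.
  rewrite g_sigma_preimage_comp => prefS _ A mA.
  by apply: prefS; exists A.
apply: smallest_sub; first exact: sigma_algebra_measurable.
rewrite -bigcup_seq; apply: bigcup_sub => i _ A [B mB <-].
exact: mf.
Qed.

End rV_measurable_fun.

Section rV_cons.
Context (R : realType) (m : nat).

Definition rV_cons (p : measurableTypeR R * 'rV[R]_m) : 'rV[R]_m.+1 :=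
  row_mx (const_mx p.1 : 'rV[R]_1) p.2.

Lemma measurable_rV_cons : measurable_fun setT rV_cons.
Proof.
apply: measurable_fun_rV => i; rewrite /rV_cons.
under eq_fun do rewrite mxE.
case: splitP => j _; first by under eq_fun do rewrite mxE; exact: measurable_fst.
exact: (measurableT_comp (@measurable_rV_coord R m j) measurable_snd).
Qed.

Definition rV_uncons (x : 'rV[R]_m.+1) : measurableTypeR R * 'rV[R]_m :=
  (x ord0 ord0, \row_j x ord0 (lift ord0 j)).

Lemma measurable_rV_uncons : measurable_fun setT rV_uncons.
Proof.
apply/measurable_fun_pairP; split; first exact: (@measurable_rV_coord R m.+1).
apply: measurable_fun_rV => i /=; under eq_fun do rewrite mxE.
exact: (@measurable_rV_coord R m.+1).
Qed.

Lemma rV_consK : cancel rV_cons rV_uncons.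
Proof.
move=> [a x]; rewrite /rV_cons /rV_uncons; congr pair.
  by rewrite mxE; case: splitP => // j _; rewrite mxE.
apply/rowP => j; rewrite !mxE; case: splitP => k /=.
  by rewrite ord1.
by rewrite /bump add1n add1n => -[] /val_inj ->.
Qed.

End rV_cons.

Fixpoint rV_lebesgue {R : realType} {n : nat} {struct n} : set 'rV[R]_n -> \bar R :=
  match n with
  | 0 => dirac (0 : 'rV[R]_0)
  | m.+1 =>
    pushforward (@lebesgue_measure R \x @rV_lebesgue R m)%E (@rV_cons R m)
  end.


Section rV_lebesgue_step.
Context (R : realType) (m : nat).
Variable mu : {sigma_finite_measure set 'rV[R]_m -> \bar R}.

Let step : set 'rV[R]_m.+1 -> \bar R :=
  pushforward (@lebesgue_measure R \x mu)%E (@rV_cons R m).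

HB.instance Definition _ := Measure.copy step
  (measure_function_pushforward__canonical__measure_function_Measure
    (@lebesgue_measure R \x mu)%E (@measurable_rV_cons R m)).

Let step_sigma_finite : sigma_finite setT step.
Proof.
have /sigma_finiteP[F [TF ndF Foo]] := sigma_finiteT (@lebesgue_measure R).
have /sigma_finiteP[G [TG ndG Goo]] := sigma_finiteT mu.
exists (fun i => @rV_uncons R m @^-1` (F i `*` G i)).
  rewrite -preimage_bigcup (_ : \bigcup_i _ = setT) ?preimage_setT//.
  rewrite -setXTT TF TG predeqE => -[x y]; split.
    by move=> [i _ []/= ? ?]; split; exists i.
  move=> [/= [i _ Fix] [k _ Gky]]; exists (maxn i k) => //; split.
  - by move: x Fix; exact/subsetPset/ndF/leq_maxl.
  - by move: y Gky; exact/subsetPset/ndG/leq_maxr.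
move=> i; have [mF lF] := Foo i; have [mG lG] := Goo i; split.
  rewrite -[X in measurable X]setTI; apply: measurable_rV_uncons => //.
  exact: measurableX.
rewrite /step /pushforward -comp_preimage (_ : _ \o _ = id); last first.
  by apply/funext => p /=; rewrite rV_consK.
by rewrite preimage_id product_measure1E// lte_mul_pinfty// ge0_fin_numE.
Qed.

HB.instance Definition _ := Measure_isSigmaFinite.Build _ _ _
  step step_sigma_finite.

Lemma rV_lebesgue_step :
  exists nu : {sigma_finite_measure set 'rV[R]_m.+1 -> \bar R},
    pushforward (@lebesgue_measure R \x mu)%E (@rV_cons R m) = nu.
Proof. by exists step. Qed.

End rV_lebesgue_step.

Section rV_lebesgue_measure.
Context (R : realType).

Lemma rV_lebesgue_ex n : exists mu : {sigma_finite_measure set 'rV[R]_n -> \bar R},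
  @rV_lebesgue R n = mu.
Proof.
elim: n => [|n [mu IH]] /=; first by eexists.
by rewrite IH; exact: rV_lebesgue_step.
Qed.

Variable n : nat.

Let rV_lebesgue0 : @rV_lebesgue R n set0 = 0%E.
Proof. by have [mu ->] := rV_lebesgue_ex n; exact: measure0. Qed.

Let rV_lebesgue_ge0 A : (0 <= @rV_lebesgue R n A)%E.
Proof. by have [mu ->] := rV_lebesgue_ex n; exact: measure_ge0. Qed.

Let rV_lebesgue_sigma_additive : semi_sigma_additive (@rV_lebesgue R n).
Proof.
by have [mu ->] := rV_lebesgue_ex n; exact: measure_semi_sigma_additive.
Qed.

HB.instance Definition _ := isMeasure.Build _ _ _ (@rV_lebesgue R n)
  rV_lebesgue0 rV_lebesgue_ge0 rV_lebesgue_sigma_additive.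

Let rV_lebesgue_sigma_finite : sigma_finite setT (@rV_lebesgue R n).
Proof. by have [mu ->] := rV_lebesgue_ex n; exact: sigma_finiteT. Qed.

HB.instance Definition _ := Measure_isSigmaFinite.Build _ _ _
  (@rV_lebesgue R n) rV_lebesgue_sigma_finite.

End rV_lebesgue_measure.

Lemma rV_lebesgue_box (R : realType) n (A : 'I_n -> set R) :
  (forall i, measurable (A i)) ->
  rV_lebesgue [set x : 'rV[R]_n | forall i, A i (x ord0 i)] =
  (\prod_(i < n) lebesgue_measure (A i))%E.
Proof.
elim: n A => [|n IH] A mA /=.
  by rewrite big_ord0 diracE mem_set//= => -[].
have mB : measurable [set x : 'rV[R]_n | forall i, A (lift ord0 i) (x ord0 i)].
  have -> : [set x : 'rV[R]_n | forall i, A (lift ord0 i) (x ord0 i)] =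
      \bigcap_(i in setT) (@rV_coord R n i @^-1` A (lift ord0 i)).
    by apply/seteqP; split => x /= H i; [move=> _; exact: H|exact: H].
  apply: fin_bigcap_measurable => // i _.
  by rewrite -[X in measurable X]setTI; exact: measurable_rV_coord.
rewrite big_ord_recl -IH//.
rewrite -(@product_measure1E _ _ _ _ _ lebesgue_measure rV_lebesgue _ _ (mA ord0) mB).
apply: (congr1 (product_measure1 (@lebesgue_measure R) (@rV_lebesgue R n))).
have cE (p : measurableTypeR R * 'rV[R]_n) : (rV_cons p ord0 ord0 = p.1) *
    (forall j, rV_cons p ord0 (lift ord0 j) = p.2 ord0 j).
  have := rV_consK p; case: p => a x [/= ea ex]; split => // j.
  by rewrite -{2}ex mxE.
apply/seteqP; split => p /=.
  move=> H; split; first by rewrite -cE.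
  by move=> i; rewrite -cE; exact: H.
by move=> [Aa Ax] i; case: (unliftP ord0 i) => [j ->|->]; rewrite cE.
Qed.

(** The topology of ['rV[R]_n] comes from the sup norm, hence a separate
    Euclidean norm. *)
Definition enorm {R : realType} {n : nat} (x : 'rV[R]_n) : R :=
  Num.sqrt (\sum_(i < n) x ord0 i ^+ 2).

Section enorm.
Context (R : realType) (n : nat).
Implicit Type x : 'rV[R]_n.

Lemma measurable_enorm : measurable_fun setT (@enorm R n).
Proof.
apply: (@measurableT_comp _ _ _ _ _ _ (@Num.sqrt R)).
  by apply: nondecreasing_measurable => // a b; exact: ler_wsqrtr.
by apply: measurable_sum => i; apply: measurable_funX; exact: measurable_rV_coord.
Qed.

Lemma enorm_ge0 x : 0 <= enorm x. Proof. exact: sqrtr_ge0. Qed.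

Lemma ler_coord_enorm x i : `|x ord0 i| <= enorm x.
Proof.
rewrite -sqrtr_sqr ler_wsqrtr// (bigD1 i)//= lerDl.
by apply: sumr_ge0 => j _; exact: sqr_ge0.
Qed.

Lemma measurable_normalize :
  measurable_fun setT (fun x => (enorm x)^-1 *: x : 'rV[R]_n).
Proof.
apply: measurable_fun_rV => i; under eq_fun do rewrite mxE.
apply: measurable_funM; last exact: measurable_rV_coord.
rewrite (_ : (fun x => _) = (fun r => r `^ (-1)) \o @enorm R n); last first.
  by apply/funext => x /=; rewrite powR_inv1// enorm_ge0.
by apply: measurableT_comp; [exact: measurable_powR|exact: measurable_enorm].
Qed.

End enorm.

Definition usphere {R : realType} {n : nat} : set 'rV[R]_n :=
  [set x | enorm x = 1].

(** Surface measure of the unit sphere, extended by zero to ['rV[R]_n]: it is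
    the measure for which integration in polar coordinates holds, i.e.
    S(A) = n * |{r w : 0 < r < 1, w in A}| for A in the sphere. *)
Definition sphere_measure {R : realType} {n : nat} (A : set 'rV[R]_n) : \bar R :=
  (n%:R%:E * rV_lebesgue
    [set x : 'rV[R]_n | (0 < enorm x < 1)%R /\ A ((enorm x)^-1 *: x)%R])%E.

Section sphere_measure.
Context (R : realType) (n : nat).

Let D : set 'rV[R]_n := [set x | 0 < enorm x < 1].

Let mD : measurable D.
Proof.
have -> : D = @enorm R n @^-1` `]0, 1[.
  by apply/seteqP; split => x /=; rewrite in_itv.
by rewrite -[X in measurable X]setTI; apply: measurable_enorm.
Qed.

Let S : {measure set 'rV[R]_n -> \bar R} :=
  mscale n%:R%:nng
    (measure_function_pushforward__canonical__measure_function_Measure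
      (mrestr rV_lebesgue mD) (@measurable_normalize R n)).

Let SE : @sphere_measure R n = S.
Proof.
apply/funext => A; rewrite /S /= /mscale /= /pushforward /mrestr.
by congr (_ * rV_lebesgue _)%E; rewrite setIC.
Qed.

Let sphere_measure0 : @sphere_measure R n set0 = 0%E.
Proof. by rewrite SE measure0. Qed.

Let sphere_measure_ge0 A : (0 <= @sphere_measure R n A)%E.
Proof. by rewrite SE measure_ge0. Qed.

Let sphere_measure_sigma_additive : semi_sigma_additive (@sphere_measure R n).
Proof. by rewrite SE; exact: measure_semi_sigma_additive. Qed.

HB.instance Definition _ := isMeasure.Build _ _ _ (@sphere_measure R n)
  sphere_measure0 sphere_measure_ge0 sphere_measure_sigma_additive.

Let sphere_measure_fin : fin_num_fun (@sphere_measure R n).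
Proof.
apply: lty_fin_num_fun; rewrite /sphere_measure.
pose B := [set x : 'rV[R]_n | forall i, `[-1, 1]%classic (x ord0 i)].
have mB : measurable B.
  have -> : B = \bigcap_(i in setT) (@rV_coord R n i @^-1` `[-1, 1]).
    by apply/seteqP; split => x /= H i; [move=> _; exact: H|exact: H].
  apply: fin_bigcap_measurable => // i _.
  by rewrite -[X in measurable X]setTI; apply: measurable_rV_coord.
rewrite lte_mul_pinfty ?lee_fin//.
rewrite (_ : [set x | _ /\ _] = D); last first.
  by apply/seteqP; split => x //= [].
apply: (@le_lt_trans _ _ (rV_lebesgue B)).
  apply: le_measure; rewrite ?inE// => x /= /andP[_ x1] i.
  by rewrite /= in_itv /= -ler_norml (le_trans (ler_coord_enorm _ _))// ltW.
rewrite /B (rV_lebesgue_box (A := fun=> `[-1, 1]%classic))//.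
rewrite -ge0_fin_numE; last by apply: prode_ge0.
elim/big_rec : _ => // i x _ xfin; apply: fin_numM => //.
by rewrite lebesgue_measure_itv /= fun_if; case: ifP.
Qed.

HB.instance Definition _ := Measure_isFinite.Build _ _ _
  (@sphere_measure R n) sphere_measure_fin.

End sphere_measure.

Section exterior_problem.
Context {R : realType} {N : nat}.
Implicit Types (phi u : R * 'rV[R]_N -> R) (z : R * 'rV[R]_N).

Definition Omega : set (R * 'rV[R]_N) := [set z | 0 < z.1 /\ 1 <= enorm z.2].

Definition Gamma : set (R * 'rV[R]_N) := [set z | 0 < z.1 /\ usphere z.2].

Lemma measurable_Omega : measurable (Omega : set (measurableTypeR R * 'rV[R]_N)).
Proof.
have -> : Omega = `]0, +oo[%classic `*` (@enorm R N @^-1` `[1, +oo[).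
  by apply/seteqP; split => z /=; rewrite !in_itv /= !andbT.
apply: measurableX; first exact: measurable_itv.
by rewrite -[X in measurable X]setTI; apply: measurable_enorm.
Qed.

Lemma measurable_Gamma : measurable (Gamma : set (measurableTypeR R * 'rV[R]_N)).
Proof.
have -> : Gamma = `]0, +oo[%classic `*` (@enorm R N @^-1` [set 1]).
  by apply/seteqP; split => z /=; rewrite !in_itv /= !andbT.
apply: measurableX; first exact: measurable_itv.
by rewrite -[X in measurable X]setTI; apply: measurable_enorm.
Qed.

Definition dt phi z : R := derive1 (fun s : R => phi (s, z.2)) z.1.

Definition dx (v : 'rV[R]_N) phi z : R := 'D_v (fun x => phi (z.1, x)) z.2.

Definition unitv (i : 'I_N) : 'rV[R]_N := delta_mx ord0 i.

Definition laplacian phi z : R := \sum_(i < N) dx (unitv i) (dx (unitv i) phi) z.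

(** div_x (phi x / |x|^2), the field being differentiated as a whole *)
Definition div_drift phi z : R :=
  \sum_(i < N) dx (unitv i) (fun y => phi y * y.2 ord0 i / enorm y.2 ^+ 2) z.

(** On [Gamma] the normal exterior to the complement of the ball is nu(x) = - x. *)
Definition dnu phi z : R := dx (- z.2) phi z.

(** [Omega] is not open: it contains [Gamma]. As usual for C^k classes on such
    sets, C^{1,2}(Omega) consists of the restrictions of functions that are
    C^{1,2} on an open neighbourhood of [Omega]. The derivatives on [Gamma] do
    not depend on the extension, being limits of derivatives from inside. *)
Definition C12 phi : Prop :=
  exists U : set (R * 'rV[R]_N), [/\ open U, Omega `<=` U &
    forall z, U z ->
      [/\ {for z, continuous phi},
          derivable (fun s : R => phi (s, z.2)) z.1 1 /\
            {for z, continuous (dt phi)},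
          forall i, derivable (fun x => phi (z.1, x)) z.2 (unitv i) /\
            {for z, continuous (dx (unitv i) phi)} &
          forall i j,
            derivable (fun x => dx (unitv i) phi (z.1, x)) z.2 (unitv j) /\
            {for z, continuous (dx (unitv j) (dx (unitv i) phi))}]].

(** Only the values on [Omega] matter, whence the intersection. *)
Definition compactly_supported phi : Prop :=
  let supp := closure (Omega `&` [set z | phi z != 0]) in
  compact supp /\ supp `<=` Omega.

Definition test_Neumann (k : R) phi : Prop :=
  [/\ C12 phi, forall z, Omega z -> 0 <= phi z, compactly_supported phi &
      forall z, Gamma z -> dnu phi z + k * phi z = 0].

Definition test_Dirichlet phi : Prop :=
  [/\ C12 phi, forall z, Omega z -> 0 <= phi z, compactly_supported phi,
      forall z, Gamma z -> phi z = 0 &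
      forall z, Gamma z -> dnu phi z <= 0].

Definition volume : set (measurableTypeR R * 'rV[R]_N) -> \bar R :=
  (lebesgue_measure \x rV_lebesgue)%E.

Definition lateral : set (measurableTypeR R * 'rV[R]_N) -> \bar R :=
  (lebesgue_measure \x sphere_measure)%E.

Definition Lp_loc (p : R) u : Prop :=
  measurable_fun (Omega : set (measurableTypeR R * 'rV[R]_N)) u /\
  forall K : set (R * 'rV[R]_N), compact K -> K `<=` Omega ->
    (\int[volume]_(z in K) (`|u z| `^ p)%:E < +oo)%E.

Definition source (alpha sigma p : R) u phi : \bar R :=
  (\int[volume]_(z in Omega)
     (z.1 `^ alpha * enorm z.2 `^ sigma * `|u z| `^ p * phi z)%:E)%E.

Definition adjoint (k : R) u phi : \bar R :=
  (- (\int[volume]_(z in Omega) (u z * dt phi z)%:E)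
   + \int[volume]_(z in Omega)
       ((- laplacian phi z + k * div_drift phi z) * u z)%:E)%E.

Definition weak_solution_Neumann (k sigma alpha p : R) (f : 'rV[R]_N -> R) u :=
  Lp_loc p u /\
  forall phi, test_Neumann k phi ->
    (source alpha sigma p u phi
     + \int[lateral]_(z in Gamma) (f z.2 * phi z)%:E
     <= adjoint k u phi)%E.

Definition weak_solution_Dirichlet (k sigma alpha p : R) (f : 'rV[R]_N -> R) u :=
  Lp_loc p u /\
  forall psi, test_Dirichlet psi ->
    (source alpha sigma p u psi
     - \int[lateral]_(z in Gamma) (f z.2 * dnu psi z)%:E
     <= adjoint k u psi)%E.

End exterior_problem.

(* Main.v *)
Require Import Defs.
From mathcomp Require Import all_boot all_order all_algebra.
From mathcomp Require Import all_classical all_reals all_analysis.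
From mathcomp Require Import measurable_realfun ring lra.

Import Order.TTheory GRing.Theory Num.Theory.
Import numFieldNormedType.Exports.

(** The proof is by test functions.  A weak solution is tested against
      phi(t,x) = eta(t) h(r) chi(r),   r = |x|^2,
    where h is an exact radial solution of the adjoint equation
      - Delta h + k div (h x / |x|^2) = 0
    with the boundary condition of the problem on |x| = 1, and eta, chi are
    cut-offs at the scales t ~ P and r <~ P (parabolic scaling).  If
    k <> 2-N, the radial solutions are spanned by |x|^k and |x|^(2-N):
    |x|^k satisfies the Neumann-type condition, and |x|^(2-N) - |x|^k vanishes
    on the sphere; if k = 2-N, the latter is replaced by |x|^(2-N) ln |x|^2.
    The hypothesis k <= 2-N makes the latter nonnegative on |x| >= 1.

    Since h solves the adjoint equation, the operator applied to phi only
    produces terms in which chi is differentiated ([adjoint_testfun]), and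
    these carry the factor 1/P; so does the time derivative.  The elementary
    inequality [young_split] absorbs the terms that contain u into the source
    term t^alpha |x|^sigma |u|^p phi ([test_inequality]), and leaves a remainder
    independent of u.  With s = 1/(p-1) and h <= C r^B, it is at most
      C P^(-1-s-alpha s) (r^b + P^b)
    on the cylinder P <= t <= 3P, 1 <= r <= 1+P, for every b >= B - sigma s/2.
    If b > -N/2, summation over dyadic shells ([annulus_integral]) bounds its
    integral by C P P^e, where e = -1 - s - alpha s + b + N/2.

    The boundary term equals a positive constant times
      (int eta) * int_(|x|=1) f  >=  c P int_(|x|=1) f,
    so that c int f <= C P^e for all P = 4^n, which is absurd if e < 0 and
    int f > 0 ([no_test_inequality]).  Such a b exists as soon as
      (2B + N - 2) (p - 1) < sigma + 2 (alpha + 1):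
    the alternative b = -N/2 + 1/2 gives e < 0 because alpha >= -1, and the
    alternative b = B - sigma s/2 gives e < 0 by this inequality.  For the
    Neumann-type problem 2B = k, so the left-hand side is nonpositive, and the
    right-hand side is positive.  For the Dirichlet-type problem 2B = 2-N makes
    the left-hand side vanish; in the logarithmic case 2B = 2-N + 2 eps with eps
    small. *)

Set Implicit Arguments.
Unset Strict Implicit.
Unset Printing Implicit Defensive.

Local Open Scope classical_set_scope.
Local Open Scope ring_scope.

(** * Functions of the form a(t) b(|x|^2) *)

Lemma is_deriveE {R : numFieldType} {V W : normedModType R} (f : V -> W) a v df :
  is_derive a v f df -> 'D_v f a = df.
Proof. by case. Qed.

Lemma is_derive_continuous {R : realType} (f : R -> R) (r d : R) :
  is_derive r 1 f d -> {for r, continuous f}.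
Proof. by move=> [db _]; apply: differentiable_continuous; exact/derivable1_diffP. Qed.

Section radial.
Context {R : realType} {N : nat}.
Implicit Types (x v : 'rV[R]_N).

(** The radial variable is |x|^2 rather than |x|: it is a polynomial, so that
    radial functions are as regular as their profiles away from the origin. *)
Definition sqnorm x : R := \sum_(i < N) x ord0 i ^+ 2.

Lemma sqnorm_ge0 x : 0 <= sqnorm x.
Proof. by apply: sumr_ge0 => i _; exact: sqr_ge0. Qed.

Lemma enorm_sq x : enorm x ^+ 2 = sqnorm x.
Proof. by rewrite /enorm sqr_sqrtr// sqnorm_ge0. Qed.

Lemma enorm_ge1 x : (1 <= enorm x) = (1 <= sqnorm x).
Proof. by rewrite -enorm_sq -{2}[1](expr1n _ 2) ler_pXn2r// nnegrE ?enorm_ge0. Qed.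

Lemma usphere_sqnorm x : usphere x -> sqnorm x = 1.
Proof. by rewrite /usphere/= -enorm_sq => ->; rewrite expr1n. Qed.

Lemma continuous_sqnorm : continuous sqnorm.
Proof.
apply: continuous_big => [|i _ x]; first exact: add_continuous.
by apply: (@continuous_comp _ _ _ (fun y : 'rV[R]_N => y ord0 i) (fun a => a ^+ 2));
  [exact: coord_continuous|exact: exprn_continuous].
Qed.

(** A directional derivative is the derivative at 0 along a line, which brings
    all spatial derivatives back to one real variable. *)
Lemma is_derive_along (W : normedModType R) (f : 'rV[R]_N -> W) x v d :
  is_derive (0 : R) 1 (fun h : R => f (h *: v + x)) d -> is_derive x v f d.
Proof.
move=> [df <-]; split; first by apply/derivable1P; exact: df.
rewrite /derive; set q1 := fun h => h^-1 *: _; set q2 := fun h => h^-1 *: _.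
suff -> : q1 = q2 by [].
by apply/funext => h; rewrite /q1 /q2 /= addr0 scale0r add0r [_%:A]mulr1.
Qed.

Lemma sqnorm_line x v h : sqnorm (h *: v + x) =
  sqnorm x + h * (2 * \sum_(i < N) x ord0 i * v ord0 i) + h * h * sqnorm v.
Proof.
rewrite /sqnorm !mulr_sumr -!big_split/=; apply: eq_bigr => i _.
by rewrite !mxE; ring.
Qed.

Lemma is_derive_quadratic (a b c : R) :
  is_derive (0 : R) 1 (fun h : R => a + h * b + h * h * c) b.
Proof.
have di : is_derive (0 : R) 1 id (1 : R) by exact: is_derive_id.
have dc (e : R) : is_derive (0 : R) 1 (cst e) (0 : R) by exact: is_derive_cst.
have := is_deriveD (is_deriveD (dc a) (is_deriveM di (dc b)))
  (is_deriveM (is_deriveM di di) (dc c)).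
rewrite (_ : 0 + _ + _ = b) // /GRing.scale/= /cst; ring.
Qed.

Lemma is_derive_radial (g : R -> R) x v (d : R) : is_derive (sqnorm x) 1 g d ->
  is_derive x v (fun y => g (sqnorm y)) (d * (2 * \sum_(i < N) x ord0 i * v ord0 i)).
Proof.
set b := 2 * _ => dg; apply: is_derive_along.
under eq_fun do rewrite sqnorm_line -/b.
apply: (@is_derive1_comp _ g _ 0 d b _ (is_derive_quadratic _ _ _)).
by rewrite !mul0r !addr0.
Qed.

Lemma sum_unitv x i : \sum_(j < N) x ord0 j * (@unitv R N i) ord0 j = x ord0 i.
Proof.
rewrite (bigD1 i)//= !mxE !eqxx mulr1 big1 ?addr0// => j ji.
by rewrite !mxE eqxx (negPf ji) mulr0.
Qed.

Lemma is_derive_coord x v i :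
  is_derive x v (fun y : 'rV[R]_N => y ord0 i) (v ord0 i).
Proof.
apply: is_derive_along; under eq_fun do rewrite !mxE.
have : is_derive (0 : R) 1 (id * cst (v ord0 i) + cst (x ord0 i)) (v ord0 i).
  by apply: is_derive_eq; rewrite /cst/= /GRing.scale/=; ring.
by [].
Qed.

Section radial_function.
Variables (eta eta1 g g1 g2 : R -> R).
Hypothesis eta_der : forall t : R, is_derive t 1 eta (eta1 t).
Hypothesis eta1_cont : continuous eta1.
Hypothesis g_der : forall r : R, 0 < r -> is_derive r 1 g (g1 r).
Hypothesis g1_der : forall r : R, 0 < r -> is_derive r 1 g1 (g2 r).
Hypothesis g2_cont : forall r : R, 0 < r -> {for r, continuous g2}.

Definition radial (a b : R -> R) (z : R * 'rV[R]_N) : R := a z.1 * b (sqnorm z.2).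

Let phi := radial eta g.

Let U : set (R * 'rV[R]_N) := [set z | 0 < sqnorm z.2].

Let near_U x : 0 < sqnorm x -> \forall y \near x, 0 < sqnorm y.
Proof.
move=> x0; apply: (@cvgr_gt R _ (nbhs x) _ sqnorm (sqnorm x)) => //.
exact: continuous_sqnorm.
Qed.

Let continuous_fst (z : R * 'rV[R]_N) :
  {for z, continuous (fst : R * 'rV[R]_N -> R)}.
Proof. exact: cvg_fst. Qed.

Let continuous_snd (z : R * 'rV[R]_N) :
  {for z, continuous (snd : R * 'rV[R]_N -> 'rV[R]_N)}.
Proof. exact: cvg_snd. Qed.

Let continuous_radius (b : R -> R) (z : R * 'rV[R]_N) :
  {for sqnorm z.2, continuous b} -> {for z, continuous (fun y => b (sqnorm y.2))}.
Proof.
move=> cb.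
have cs : {for z, continuous (fun y : R * 'rV[R]_N => sqnorm y.2)}.
  exact: (continuous_comp (@continuous_snd z) (@continuous_sqnorm z.2)).
exact: (continuous_comp cs cb).
Qed.

Let continuous_time (a : R -> R) (z : R * 'rV[R]_N) :
  {for z.1, continuous a} -> {for z, continuous (fun y => a y.1)}.
Proof. exact: (continuous_comp (@continuous_fst z)). Qed.

Let continuous_coord i (z : R * 'rV[R]_N) :
  {for z, continuous (fun y : R * 'rV[R]_N => y.2 ord0 i)}.
Proof.
exact: (continuous_comp (@continuous_snd z) (@coord_continuous _ _ _ ord0 i z.2)).
Qed.

Lemma is_derive_dt (z : R * 'rV[R]_N) :
  is_derive z.1 1 (fun t => phi (t, z.2)) (eta1 z.1 * g (sqnorm z.2)).
Proof.
have -> : (fun t => phi (t, z.2)) = g (sqnorm z.2) \*: eta.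
  by apply/funext => t; rewrite /phi /radial/= mulrC.
by rewrite mulrC; apply: is_deriveZ.
Qed.

Lemma dt_radial z : dt phi z = radial eta1 g z.
Proof. by rewrite /dt derive1E (is_deriveE (is_derive_dt z)). Qed.

Lemma is_derive_dx v z : 0 < sqnorm z.2 ->
  is_derive z.2 v (fun x => phi (z.1, x))
    (eta z.1 * (g1 (sqnorm z.2) * (2 * \sum_(i < N) z.2 ord0 i * v ord0 i))).
Proof.
move=> z0; have dg := is_derive_radial v (g_der z0).
have : is_derive z.2 v (eta z.1 \*: (fun y => g (sqnorm y)))
  (eta z.1 *: (g1 (sqnorm z.2) * (2 * \sum_(i < N) z.2 ord0 i * v ord0 i))).
  by apply: is_deriveZ.
by [].
Qed.

Lemma dx_radial v z : 0 < sqnorm z.2 ->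
  dx v phi z = eta z.1 * (g1 (sqnorm z.2) * (2 * \sum_(i < N) z.2 ord0 i * v ord0 i)).
Proof. by move=> z0; rewrite /dx (is_deriveE (is_derive_dx v z0)). Qed.

Lemma dx_unitv_radial i z : 0 < sqnorm z.2 ->
  dx (unitv i) phi z = eta z.1 * (g1 (sqnorm z.2) * (2 * z.2 ord0 i)).
Proof. by move=> z0; rewrite dx_radial// sum_unitv. Qed.

Lemma is_derive_coord_radial (b b1 : R -> R) i v x : 0 < sqnorm x ->
  is_derive (sqnorm x) 1 b (b1 (sqnorm x)) ->
  is_derive x v (fun y : 'rV[R]_N => b (sqnorm y) * y ord0 i)
    (b1 (sqnorm x) * (2 * \sum_(i < N) x ord0 i * v ord0 i) * x ord0 i
     + b (sqnorm x) * v ord0 i).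
Proof.
move=> x0 db; have d1 := is_derive_radial v db; have d2 := is_derive_coord x v i.
have := @is_deriveM _ _ _ _ x v _ _ d1 d2.
rewrite (_ : _ *: _ + _ = b1 (sqnorm x) * (2 * \sum_(i < N) x ord0 i * v ord0 i) * x ord0 i
     + b (sqnorm x) * v ord0 i); last by rewrite /GRing.scale/=; ring.
by [].
Qed.

Lemma is_derive_dx2 i v z : 0 < sqnorm z.2 ->
  is_derive z.2 v (fun x => dx (unitv i) phi (z.1, x))
    (2 * eta z.1 * (g2 (sqnorm z.2) * (2 * \sum_(i < N) z.2 ord0 i * v ord0 i) * z.2 ord0 i
       + g1 (sqnorm z.2) * v ord0 i)).
Proof.
move=> z0; have dd := @is_derive_coord_radial g1 g2 i v z.2 z0 (g1_der z0).
apply: (@near_eq_is_derive _ _ _ ((2 * eta z.1) \*: (fun y : 'rV[R]_N => g1 (sqnorm y) * y ord0 i))).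
  near=> x; rewrite dx_unitv_radial/=; last by near: x; exact: near_U.
  by rewrite /GRing.scale/=; ring.
Unshelve. all: by end_near. Qed.

(** The open set is |x| > 0, which contains [Omega]; on it every derivative of
    eta(t) g(|x|^2) has an explicit continuous formula. *)
Lemma C12_radial : C12 phi.
Proof.
have cg r : 0 < r -> {for r, continuous g}.
  by move=> r0; exact: is_derive_continuous (g_der r0).
have cg1 r : 0 < r -> {for r, continuous g1}.
  by move=> r0; exact: is_derive_continuous (g1_der r0).
have ceta t : {for t, continuous eta} by exact: is_derive_continuous (eta_der t).
have near_U2 z : U z -> \forall y \near z, 0 < sqnorm y.2.
  move=> z0.
  have : {for z, continuous (fun y : R * 'rV[R]_N => sqnorm y.2)}.
    by apply: (@continuous_radius id); exact: cvg_id.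
  by move=> c; apply: (@cvgr_gt R _ (nbhs z) _ (fun y => sqnorm y.2) (sqnorm z.2)).
exists U; split.
- rewrite openE => z /near_U2; exact.
- by move=> z [_ /=]; rewrite enorm_ge1; exact: lt_le_trans.
move=> z z0; split.
- apply: continuousM.
    exact: continuous_time.
  by apply: continuous_radius; exact: cg.
- split.
    by case: (is_derive_dt z).
  rewrite (_ : dt phi = radial eta1 g); last by apply/funext; exact: dt_radial.
  apply: continuousM.
    apply: continuous_time; exact: eta1_cont.
  by apply: continuous_radius; exact: cg.
- move=> i; split; first by case: (is_derive_dx (unitv i) z0).
  have : {for z, continuous (fun y : R * 'rV[R]_N =>
      eta y.1 * (g1 (sqnorm y.2) * (2 * y.2 ord0 i)))}.
    apply: continuousM; first exact: continuous_time.
    apply: continuousM; first by apply: continuous_radius; exact: cg1.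
    by apply: continuousM; [exact: cst_continuous|exact: continuous_coord].
  rewrite /prop_for /continuous_at dx_unitv_radial// => h.
  apply: cvg_trans h; apply: near_eq_cvg; near=> y.
  by rewrite dx_unitv_radial//; near: y; exact: near_U2.
- move=> i j; split; first by case: (is_derive_dx2 i (unitv j) z0).
  have dxE y : 0 < sqnorm y.2 -> dx (unitv j) (dx (unitv i) phi) y =
      2 * eta y.1 * (g2 (sqnorm y.2) * (2 * y.2 ord0 j) * y.2 ord0 i
       + g1 (sqnorm y.2) * (@unitv R N j) ord0 i).
    by move=> y0; rewrite /dx (is_deriveE (is_derive_dx2 i (unitv j) y0)) sum_unitv.
  have : {for z, continuous (fun y : R * 'rV[R]_N =>
      2 * eta y.1 * (g2 (sqnorm y.2) * (2 * y.2 ord0 j) * y.2 ord0 i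
       + g1 (sqnorm y.2) * (@unitv R N j) ord0 i))}.
    apply: continuousM.
      by apply: continuousM; [exact: cst_continuous|exact: continuous_time].
    apply: continuousD.
      apply: continuousM; last exact: continuous_coord.
      apply: continuousM; first by apply: continuous_radius; exact: g2_cont.
      by apply: continuousM; [exact: cst_continuous|exact: continuous_coord].
    apply: continuousM; last exact: cst_continuous.
    by apply: continuous_radius; exact: cg1.
  rewrite /prop_for /continuous_at dxE// => h.
  apply: cvg_trans h; apply: near_eq_cvg; near=> y.
  by rewrite dxE//; near: y; exact: near_U2.
Unshelve. all: by end_near. Qed.

Lemma laplacian_radial z : 0 < sqnorm z.2 ->
  laplacian phi z = eta z.1 *
    (4 * sqnorm z.2 * g2 (sqnorm z.2) + 2 * N%:R * g1 (sqnorm z.2)).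
Proof.
move=> z0; rewrite /laplacian (eq_bigr (fun i => eta z.1 * g2 (sqnorm z.2) * 4 * z.2 ord0 i ^+ 2 +
   2 * eta z.1 * g1 (sqnorm z.2))); last first.
  move=> i _; rewrite /dx (is_deriveE (is_derive_dx2 i (unitv i) z0)) sum_unitv !mxE !eqxx/=.
  ring.
by rewrite big_split/= -mulr_sumr -/(sqnorm z.2) sumr_const card_ord -mulr_natr; ring.
Qed.

(** Here g x / |x|^2 is (g(r)/r) x, whose divergence is 2 r (g/r)' + N g/r. *)
Lemma div_drift_radial z : 0 < sqnorm z.2 ->
  div_drift phi z = eta z.1 *
    (2 * g1 (sqnorm z.2) + (N%:R - 2) * (g (sqnorm z.2) / sqnorm z.2)).
Proof.
move=> z0; set r := sqnorm z.2.
pose G (s : R) := g s / s; pose G1 (s : R) := g1 s / s - g s / s ^+ 2.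
have dG : is_derive r 1 G (G1 r).
  have dv : is_derive r 1 (fun y : R => y^-1) (- r ^- 2 *: 1).
    by apply: (@is_deriveV _ id) => //; rewrite gt_eqF.
  have := @is_deriveM _ _ _ _ r 1 _ _ (g_der z0) dv.
  rewrite (_ : _ *: _ + _ = G1 r); first by [].
  by rewrite /G1 /GRing.scale/=; ring.
rewrite /div_drift (eq_bigr (fun i => eta z.1 * (2 * G1 r * z.2 ord0 i ^+ 2 + G r))); last first.
  move=> i _; rewrite /dx.
  have dd := @is_derive_coord_radial G G1 i (unitv i) z.2 z0 dG.
  have -> : (fun x : 'rV[R]_N => phi (z.1, x) * (z.1, x).2 ord0 i / enorm (z.1, x).2 ^+ 2) =
     (eta z.1 \*: (fun y : 'rV[R]_N => G (sqnorm y) * y ord0 i)).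
    apply/funext => y /=; rewrite enorm_sq /phi /radial/= /GRing.scale/= /G; ring.
  rewrite (is_deriveE (is_deriveZ (eta z.1) dd)) sum_unitv !mxE !eqxx/= /GRing.scale/=.
  by rewrite -/r; ring.
rewrite -mulr_sumr big_split/= -mulr_sumr -/(sqnorm z.2) sumr_const card_ord -mulr_natr -/r.
rewrite /G1 /G; field.
by rewrite gt_eqF.
Qed.

Lemma dnu_radial z : usphere z.2 -> dnu phi z = - (2 * eta z.1 * g1 1).
Proof.
move=> /usphere_sqnorm z1; rewrite /dnu dx_radial z1//.
rewrite (eq_bigr (fun i => - (z.2 ord0 i ^+ 2))); last by move=> i _; rewrite mxE; ring.
by rewrite sumrN -/(sqnorm z.2) z1; ring.
Qed.

End radial_function.

End radial.

(** * Cut-off functions in time and in space *)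

Section cutoff.
Context {R : realType}.
Implicit Types (a b r t : R) (n m l : nat).

(** With an exponent n >= 2 this truncation is of class C^(n-1), and its
    derivatives are bounded by lower powers of itself: this is what allows the
    derivatives of the cut-offs to be absorbed by the cut-offs. *)
Definition pospow n r : R := Num.max r 0 ^+ n.

Lemma pospow_ge0 n r : 0 <= pospow n r.
Proof. by rewrite exprn_ge0// le_max lexx orbT. Qed.

Lemma pospow_continuous n : continuous (pospow n).
Proof.
move=> r.
have cm : {for r, continuous (fun r : R => Num.max r 0)}.
  by apply: (@continuous_max R R id (cst 0)); [exact: cvg_id|exact: cst_continuous].
exact: (continuous_comp cm (@exprn_continuous R n _)).
Qed.

Lemma is_derive_pow (f : R -> R) n r d : is_derive r 1 f d ->
  is_derive r 1 (fun t => f t ^+ n) (n%:R * f r ^+ n.-1 * d).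
Proof.
move=> df; have -> : (fun t => f t ^+ n) = f ^+ n by rewrite exprfctE.
exact: (is_deriveX n df).
Qed.

Lemma is_derive_pospow n r : is_derive r 1 (pospow n.+2) (n.+2%:R * pospow n.+1 r).
Proof.
have [r0|r0|->] := ltgtP r 0.
- apply: (@near_eq_is_derive _ _ _ (cst 0)).
    near=> t; rewrite /pospow max_r ?expr0n//.
    by apply: ltW; near: t; exact: lt_nbhsl.
  by rewrite /pospow max_r ?ltW// expr0n mulr0; exact: is_derive_cst.
- apply: (@near_eq_is_derive _ _ _ (fun t => t ^+ n.+2)).
    near=> t; rewrite /pospow max_l//.
    by apply: ltW; near: t; exact: lt_nbhsr.
  rewrite /pospow max_l ?ltW//.
  by have := is_derive_pow n.+2 (is_derive_id r 1); rewrite mulr1.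
have qE : (fun h : R => h^-1 *: ((pospow n.+2 \o shift 0) (h *: 1) - pospow n.+2 0)) @ 0^' --> (0 : R).
  have : pospow n.+1 @ 0^' --> pospow n.+1 0.
    by apply: cvg_within_filter; exact: pospow_continuous.
  rewrite {2}/pospow maxxx expr0n/=; apply: cvg_trans; apply: near_eq_cvg.
  near=> h; have h0 : h != 0 by near: h; exact: nbhs_dnbhs_neq.
  rewrite /= /pospow maxxx expr0n/= subr0 addr0 [h *: 1]mulr1 /GRing.scale/=.
  have [hp|hn] := leP 0 h; first by rewrite [in RHS]exprS mulKf.
  by rewrite !expr0n/= mulr0.
rewrite {2}/pospow maxxx expr0n mulr0.
by split; [apply: cvgP qE|exact: cvg_lim].
Unshelve. all: by end_near. Qed.

Lemma is_derive_pospow_comp n (q : R -> R) r q1 : is_derive r 1 q q1 ->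
  is_derive r 1 (fun s => pospow n.+2 (q s)) (n.+2%:R * pospow n.+1 (q r) * q1).
Proof. by move=> dq; apply: (is_derive1_comp (is_derive_pospow n (q r)) dq). Qed.

(** Supported, once truncated, in T <= t <= 3T. *)
Definition eta_base T t : R := 1 - ((t - 2 * T) / T) ^+ 2.

Definition eta l T t : R := pospow l.+2 (eta_base T t).

Definition eta1 l T t : R := l.+2%:R * pospow l.+1 (eta_base T t) * (((t - 2 * T) / T) * (- 2 / T)).

Lemma is_derive_affine a b r : is_derive r 1 (fun t => (t - a) / b) b^-1.
Proof.
have := is_deriveM (is_deriveB (is_derive_id r 1) (is_derive_cst a r 1))
  (is_derive_cst b^-1 r 1).
rewrite (_ : _ *: _ + _ = b^-1)// /GRing.scale/= /cst; ring.
Qed.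

Lemma is_derive_affineX a b n r :
  is_derive r 1 (fun t => ((t - a) / b) ^+ n) (n%:R * ((r - a) / b) ^+ n.-1 * b^-1).
Proof. exact: is_derive_pow (is_derive_affine a b r). Qed.

Lemma is_derive_eta l T t : is_derive t 1 (eta l T) (eta1 l T t).
Proof.
apply: is_derive_pospow_comp.
have := is_deriveB (is_derive_cst (1 : R) t 1) (is_derive_affineX (2 * T) T 2 t).
by rewrite (_ : 0 - _ = (((t - 2 * T) / T) * (- 2 / T)))//; ring.
Qed.

Lemma eta_base_continuous T : continuous (eta_base T).
Proof.
move=> t; have := is_deriveB (is_derive_cst (1 : R) t 1) (is_derive_affineX (2 * T) T 2 t).
by move=> [db _]; apply: differentiable_continuous; exact/derivable1_diffP.
Qed.

Lemma eta1_continuous l T : continuous (eta1 l T).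
Proof.
move=> t.
suff : {for t, continuous (fun t =>
  l.+2%:R * pospow l.+1 (eta_base T t) * (((t - 2 * T) / T) * (- 2 / T)))} by [].
apply: continuousM.
  apply: continuousM; first exact: cst_continuous.
  exact: (continuous_comp (@eta_base_continuous T t) (@pospow_continuous _ _)).
apply: continuousM; last exact: cst_continuous.
have [db _] := is_derive_affine (2 * T) T t.
by apply: differentiable_continuous; exact/derivable1_diffP.
Qed.

(** The value at r = 1 is 1 and the derivative there is 0, so that the cut-off
    does not disturb the boundary condition on |x| = 1.  A high power replaces
    the usual plateau of a cut-off: the derivatives are small for r much
    smaller than P. *)
Definition chi_base m P r : R := 1 - ((r - 1) / P) ^+ m.+2.

Definition chi m l P r : R := pospow l.+3 (chi_base m P r).

Definition chi_base1 m P r : R := ((r - 1) / P) ^+ m.+1 * (- m.+2%:R / P).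

Definition chi_base2 m P r : R := ((r - 1) / P) ^+ m * (- (m.+2%:R * m.+1%:R) / P ^+ 2).

Definition chi1 m l P r : R := l.+3%:R * pospow l.+2 (chi_base m P r) * chi_base1 m P r.

Definition chi2 m l P r : R :=
  l.+3%:R * (l.+2%:R * pospow l.+1 (chi_base m P r) * chi_base1 m P r) * chi_base1 m P r +
  l.+3%:R * pospow l.+2 (chi_base m P r) * chi_base2 m P r.

Lemma is_derive_chi_base m P r : is_derive r 1 (chi_base m P) (chi_base1 m P r).
Proof.
have := is_deriveB (is_derive_cst (1 : R) r 1) (is_derive_affineX 1 P m.+2 r).
by rewrite (_ : 0 - _ = chi_base1 m P r)// /chi_base1/=; ring.
Qed.

Lemma is_derive_chi_base1 m P r : is_derive r 1 (chi_base1 m P) (chi_base2 m P r).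
Proof.
have := is_deriveM (is_derive_affineX 1 P m.+1 r) (is_derive_cst (- m.+2%:R / P) r 1).
by rewrite (_ : _ *: _ + _ = chi_base2 m P r)// /chi_base2/= /GRing.scale/= expr2 invfM /cst; ring.
Qed.

Lemma is_derive_chi m l P r : is_derive r 1 (chi m l P) (chi1 m l P r).
Proof. exact: (is_derive_pospow_comp l.+1 (is_derive_chi_base m P r)). Qed.

Lemma is_derive_chi1 m l P r : is_derive r 1 (chi1 m l P) (chi2 m l P r).
Proof.
have := is_deriveM (is_deriveZ l.+3%:R (is_derive_pospow_comp l (is_derive_chi_base m P r)))
   (is_derive_chi_base1 m P r).
rewrite (_ : _ *: _ + _ = chi2 m l P r)//.
by rewrite /chi2 /GRing.scale/= /GRing.scale/=; ring.
Qed.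

Lemma chi2_continuous m l P : continuous (chi2 m l P).
Proof.
move=> r.
have cw n : {for r, continuous (fun s => pospow n (chi_base m P s))}.
  exact: (continuous_comp (is_derive_continuous (is_derive_chi_base m P r)) (@pospow_continuous _ _)).
have cd := is_derive_continuous (is_derive_chi_base1 m P r).
suff : {for r, continuous (fun r => 
  l.+3%:R * (l.+2%:R * pospow l.+1 (chi_base m P r) * chi_base1 m P r) * chi_base1 m P r +
  l.+3%:R * pospow l.+2 (chi_base m P r) *
    (((r - 1) / P) ^+ m * (- (m.+2%:R * m.+1%:R) / P ^+ 2)))} by [].
apply: continuousD.
  apply: continuousM => //; apply: continuousM; first exact: cst_continuous.
  by apply: continuousM => //; apply: continuousM => //; exact: cst_continuous.
apply: continuousM; first by apply: continuousM => //; exact: cst_continuous.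
apply: continuousM; last exact: cst_continuous.
exact: is_derive_continuous (is_derive_affineX 1 P m r).
Qed.

Lemma chi_1 m l P : chi m l P 1 = 1.
Proof. by rewrite /chi /chi_base subrr mul0r expr0n subr0 /pospow max_l ?expr1n// ler01. Qed.

Lemma chi1_1 m l P : chi1 m l P 1 = 0.
Proof. by rewrite /chi1 /chi_base1 subrr mul0r expr0n/= mul0r mulr0. Qed.

End cutoff.

(** * Pointwise estimates *)

Section pointwise.
Context {R : realType}.
Implicit Types (a b r t : R) (n m l : nat).

(** A radial solution h(|x|^2) of the adjoint equation in dimension n, with the
    two bounds used by the estimates.  The bound on (r - 1) h' replaces a bound
    on h'/h, which fails for a profile vanishing on the sphere; the factor
    r - 1 is supplied by the derivative of the space cut-off. *)
Record profile (k n B : R) (h h1 h2 : R -> R) : Prop := Profile {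
  profile_der : forall r : R, 0 < r -> is_derive r 1 h (h1 r);
  profile_der1 : forall r : R, 0 < r -> is_derive r 1 h1 (h2 r);
  profile_cont : forall r : R, 0 < r -> {for r, continuous h2};
  profile_ode : forall r : R, 0 < r ->
    4 * r * h2 r + 2 * (n - k) * h1 r - k * (n - 2) * (h r / r) = 0;
  profile_ge0 : forall r : R, 1 <= r -> 0 <= h r;
  profile_ratio : exists2 C : R, 0 <= C &
    forall r : R, 1 <= r -> (r - 1) * `|h1 r| <= C * h r;
  profile_growth : exists2 C : R, 0 <= C &
    forall r : R, 1 <= r -> h r <= C * r `^ B;
  profile_meas : measurable_fun [set: R] h;
  profile_meas1 : measurable_fun [set: R] h1 }.

(** What remains of (minus) the adjoint operator applied to h chi, once the
    adjoint equation for h is used. *)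
Definition adjoint_defect (k n : R) (h h1 : R -> R) m l P r : R :=
  4 * r * (2 * h1 r * chi1 m l P r + h r * chi2 m l P r)
  + 2 * (n - k) * h r * chi1 m l P r.

Definition adjoint_defect_cst (k n C0 : R) m l : R :=
  let a : R := l.+3%:R * m.+2%:R in 8 * a * C0 + 8 * a ^+ 2 + 2 * `|n - k| * a.

(** Every term contains a derivative of chi, that is a factor r ((r-1)/P)^m / P^2
    and two powers of the truncation less than chi itself.  In the term with
    h' chi', one factor (r - 1) of chi' is spent on h'. *)
Lemma adjoint_defect_bound (k n C0 : R) (h h1 : R -> R) m l P r :
  1 <= P -> 1 <= r -> 0 <= h r -> 0 <= C0 -> (r - 1) * `|h1 r| <= C0 * h r ->
  `|adjoint_defect k n h h1 m l P r| <=
  h r * (adjoint_defect_cst k n C0 m l * (r * ((r - 1) / P) ^+ m / P ^+ 2))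
  * pospow l.+1 (chi_base m P r).
Proof.
move=> P1 r1 h0 C00 ratio; rewrite /adjoint_defect_cst; set a : R := l.+3%:R * m.+2%:R; cbv zeta.
have P0 : 0 < P by exact: lt_le_trans P1.
have P0' := ltW P0.
set y := chi_base m P r; set d := (r - 1) / P.
have d0 : 0 <= d by rewrite /d divr_ge0 ?subr_ge0// ltW.
have a1 : 1 <= a.
  by rewrite /a -natrM -[1]/(1%:R) ler_nat.
have [y0|y0] := leP y 0.
  rewrite /adjoint_defect /chi1 /chi2 -/y /pospow max_r// !expr0n/=.
  by rewrite !(mulr0, mul0r, addr0) normr0.
have y0' := ltW y0.
have y1 : y <= 1 by rewrite /y /chi_base gerBl exprn_ge0.
have d1 : d <= 1.
  rewrite leNgt; apply/negP => d1; move: y0; rewrite /y /chi_base -/d subr_gt0.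
  by rewrite ltNge exprn_ege1// ltW.
pose Q := d ^+ m / P ^+ 2 * y ^+ l.+1.
have Q0 : 0 <= Q by rewrite /Q mulr_ge0 ?divr_ge0 ?exprn_ge0.
have yS j : y ^+ j.+1 = y * y ^+ j by exact: exprS.
have dS j : d ^+ j.+1 = d * d ^+ j by exact: exprS.
have px j : pospow j y = y ^+ j by rewrite /pospow max_l// ltW.
have dP : (r - 1) = d * P by rewrite /d divfK// gt_eqF.
have rr : r - 1 <= r by rewrite gerBl.
have r0 : 0 <= r by exact: le_trans r1.
have rm0 : 0 <= r - 1 by rewrite subr_ge0.
have aQ0 : 0 <= a * Q by apply: mulr_ge0 => //; exact: le_trans a1.
have yQ0 : 0 <= y * Q by exact: mulr_ge0.
have c1 : `|chi1 m l P r| <= a * Q * (r - 1).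
  have -> : chi1 m l P r = - (a * Q * (r - 1) * y).
    by rewrite /chi1 -/y px /chi_base1 -/d dP /Q /a (dS m) (yS l.+1); field; exact: lt0r_neq0.
  have aQr0 : 0 <= a * Q * (r - 1) by exact: mulr_ge0.
  by rewrite normrN ger0_norm ?ler_piMr//; exact: mulr_ge0.
have c2 : `|chi2 m l P r| <= 2 * a ^+ 2 * Q.
  have -> : chi2 m l P r = (l.+3%:R * l.+2%:R * m.+2%:R ^+ 2) * (d * d * d ^+ m * Q)
      - (l.+3%:R * (m.+2%:R * m.+1%:R)) * (y * Q).
    rewrite /chi2 -/y !px /chi_base1 /chi_base2 -/d /Q (dS m) (yS l.+1).
    by field; exact: lt0r_neq0.
  have ddQ0 : 0 <= d * d * d ^+ m * Q.
    by apply: mulr_ge0 => //; apply: mulr_ge0; [exact: mulr_ge0|exact: exprn_ge0].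
  have l0 : 0 <= l.+3%:R * l.+2%:R * m.+2%:R ^+ 2 :> R.
    by rewrite mulr_ge0 ?exprn_ge0 ?mulr_ge0.
  have l0' : 0 <= l.+3%:R * (m.+2%:R * m.+1%:R) :> R by rewrite !mulr_ge0.
  apply: le_trans (ler_normB _ _) _.
  rewrite (ger0_norm (mulr_ge0 l0 ddQ0)) (ger0_norm (mulr_ge0 l0' yQ0)).
  have -> : 2 * a ^+ 2 * Q = a ^+ 2 * Q + a ^+ 2 * Q by ring.
  apply: lerD.
    apply: ler_pM => //.
    - by rewrite /a exprMn ler_pM2r ?exprn_gt0// expr2 ler_pM2l// ler_nat.
    - by rewrite ler_piMl// -mulrA -!dS exprn_ile1.
  apply: ler_pM => //.
  - rewrite /a expr2 -!natrM ler_nat.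
    rewrite -[leqRHS]mulnA !leq_mul//.
    by rewrite (leq_trans (leqnSn _))// leq_pmull.
  - by rewrite ler_piMl.
rewrite /adjoint_defect px; move: (chi1 m l P r) (chi2 m l P r) c1 c2 => X1 X2 c1 c2.
rewrite (le_trans (ler_normD _ _))//.
rewrite [leRHS](_ : _ = 8 * r * (a * Q) * (C0 * h r) + 8 * r * a ^+ 2 * h r * Q +
   2 * `|n - k| * h r * (a * Q) * r); last first.
  rewrite /Q -/d; ring.
apply: lerD.
  rewrite !normrM (ger0_norm r0) !normr_nat -mulrA.
  rewrite [leRHS](_ : _ = 4 * r * (2 * (a * Q) * (C0 * h r) + 2 * a ^+ 2 * Q * h r)); last by ring.
  rewrite mulrA ler_wpM2l ?mulr_ge0// (le_trans (ler_normD _ _))//.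
  rewrite !normrM !normr_nat (ger0_norm h0) lerD//; last first.
    by rewrite [leRHS]mulrC ler_wpM2l.
  apply: (@le_trans _ _ (2 * `|h1 r| * (a * Q * (r - 1)))).
    by apply: ler_wpM2l => //; exact: mulr_ge0.
  rewrite [leLHS](_ : _ = (2 * (a * Q)) * ((r - 1) * `|h1 r|)); last by ring.
  by apply: ler_wpM2l => //; exact: mulr_ge0.
rewrite !normrM !normr_nat (ger0_norm h0) -[leRHS]mulrA ler_wpM2l ?mulr_ge0//.
by rewrite (le_trans c1)// ler_wpM2l.
Qed.

(** A form of Young's inequality that needs no duality of exponents: either lam
    is at most w v^(p-1) / 2 and the first term suffices, or v is at most
    (2 lam / w)^(1/(p-1)) and the second does. *)
Lemma young_split (p w lam v : R) : 1 < p -> 0 < w -> 0 <= lam -> 0 <= v ->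
  lam * v <= w / 2 * v `^ p + lam * (2 * lam / w) `^ (p - 1)^-1.
Proof.
move=> p1 w0 lam0 v0.
have p10 : 0 < p - 1 by rewrite subr_gt0.
have [le|gt] := leP lam (w / 2 * v `^ (p - 1)).
  apply: (@le_trans _ _ (w / 2 * v `^ p)).
    by rewrite -(mulr_powRB1 v0 (lt_trans ltr01 p1)) [v * _]mulrC mulrA ler_wpM2r.
  by rewrite lerDl mulr_ge0// powR_ge0.
apply: (@le_trans _ _ (lam * (2 * lam / w) `^ (p - 1)^-1)); last first.
  by rewrite lerDr mulr_ge0 ?powR_ge0// divr_ge0// ltW.
apply: ler_wpM2l => //.
have -> : v = (v `^ (p - 1)) `^ (p - 1)^-1.
  by rewrite -powRrM mulfV ?lt0r_neq0// powRr1.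
apply: ge0_ler_powR; rewrite ?nnegrE ?invr_ge0 ?powR_ge0//.
- exact: ltW.
- by rewrite divr_ge0 ?mulr_ge0// ltW.
apply: ltW; move: gt; rewrite ltr_pdivlMr//; lra.
Qed.

(** Application of [young_split] to v = z^(l+1) |u|.  The cut-off is z^(l+3), and
    l is so large that z^(p (l+1)) <= z^(l+3). *)
Lemma young_test (p w lam h z u : R) l : 1 < p -> 0 < w -> 0 <= lam -> 0 <= h ->
  0 <= z <= 1 -> l.+3%:R <= p * l.+1%:R ->
  `|u| * (h * lam * z ^+ l.+1) <=
  2^-1 * (w * (h * z ^+ l.+3) * `|u| `^ p) + h * (lam * (2 * lam / w) `^ (p - 1)^-1).
Proof.
move=> p1 w0 lam0 h0 /andP[z0 z1] pl.
have v0 : 0 <= z ^+ l.+1 * `|u| by rewrite mulr_ge0// exprn_ge0.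
have K := ler_wpM2l h0 (young_split p1 w0 lam0 v0).
rewrite [leLHS](_ : _ = h * (lam * (z ^+ l.+1 * `|u|))); last by ring.
apply: (le_trans K); rewrite mulrDr lerD2r.
rewrite [leRHS](_ : _ = h * (w / 2 * (z ^+ l.+3 * `|u| `^ p))); last by field.
rewrite !ler_wpM2l ?divr_ge0 ?(ltW w0)//.
rewrite powRM ?exprn_ge0// ler_wpM2r ?powR_ge0//.
rewrite -!powR_mulrn// -powRrM [l.+1%:R * p]mulrC.
have [->|zn0] := eqVneq z 0.
  by rewrite !powR0// ?pnatr_eq0// mulf_neq0 ?pnatr_eq0// gt_eqF// (lt_trans ltr01).
by apply: ger_powR => //; rewrite lt_neqAle eq_sym zn0 z0.
Qed.

End pointwise.

Section remainder.
Context {R : realType}.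
Implicit Types (a b r t : R) (n m l : nat).

Lemma powR_expR (a x : R) : 0 < a -> a `^ x = expR (x * ln a).
Proof. by move=> a0; rewrite /powR gt_eqF. Qed.

(** The remainder left by [young_test] is estimated for lam = c (r/P)^j / P: j = 0
    corresponds to the time derivative, j = m+1 to the adjoint operator.  All
    powers are written as exponentials, so that the claim is linear in the
    logarithms of P, t and r.  Since alpha <= 0, the worst time is t = 3P. *)
Lemma remainder_bound (p alpha sigma B b c Cg : R) (j : nat) :
  1 < p -> alpha <= 0 -> B - sigma / 2 / (p - 1) <= b -> 0 <= c -> 0 <= Cg ->
  let s := (p - 1)^-1 in
  exists2 C : R, 0 <= C & forall P t r H lam : R, 1 <= P -> P <= t <= 3 * P -> 1 <= r ->
    0 <= H -> H <= Cg * r `^ B -> 0 <= lam -> lam <= c * ((r / P) ^+ j / P) ->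
    H * (lam * (2 * lam / (t `^ alpha * r `^ (sigma / 2))) `^ s) <=
    C * P `^ (-1 - s - alpha * s) * (r `^ b * (r / P) `^ (j%:R * (1 + s))).
Proof.
move=> p1 al0 Bb c0 Cg0 s; have s0 : 0 < s by rewrite invr_gt0 subr_gt0.
exists (Cg * c * (2 * c) `^ s * 3 `^ (- alpha * s)).
  by rewrite !mulr_ge0 ?powR_ge0.
move=> P t r H lam P1 /andP[Pt t3P] r1 H0 HB lam0 lamc.
have P0 : 0 < P by exact: lt_le_trans P1.
have t0 : 0 < t by exact: lt_le_trans Pt.
have r0 : 0 < r by exact: lt_le_trans r1.
have x0 : 0 < r / P by rewrite divr_gt0.
set W := t `^ alpha * _.
have W0 : 0 < W by rewrite mulr_gt0// powR_gt0.
pose E := (r / P) ^+ j / P / W.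
have E0 : 0 < E by rewrite /E !divr_gt0// exprn_gt0.
have l1 : (2 * lam / W) `^ s <= (2 * c) `^ s * E `^ s.
  have c20 : 0 <= 2 * c by rewrite mulr_ge0.
  have lW0 : 0 <= 2 * lam / W by apply: divr_ge0; [exact: mulr_ge0|exact: ltW].
  rewrite -(powRM s c20 (ltW E0)); apply: ge0_ler_powR; rewrite ?nnegrE//.
  - exact: ltW.
  - by rewrite mulr_ge0// ltW.
  rewrite ler_pdivrMr// (_ : 2 * c * E * W = 2 * (c * ((r / P) ^+ j / P))).
    by rewrite ler_pM2l.
  rewrite /E; field; rewrite !lt0r_neq0//.
have lnx : ln (r / P) = ln r - ln P by rewrite ln_div.
have lnE : ln E = j%:R * (ln r - ln P) - ln P - alpha * ln t - sigma / 2 * ln r.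
  rewrite /E ln_div ?posrE ?divr_gt0 ?exprn_gt0// ln_div ?posrE ?exprn_gt0// lnXn// lnx.
  rewrite /W lnM ?posrE ?powR_gt0// !ln_powR -[_ *+ j]mulr_natl.
  by rewrite opprD addrA.
apply: (@le_trans _ _ ((Cg * r `^ B) * ((c * ((r / P) ^+ j / P)) * ((2 * c) `^ s * E `^ s)))).
  by do 2! (apply: ler_pM => //; rewrite ?mulr_ge0 ?powR_ge0//).
have -> : (r / P) ^+ j / P = expR (j%:R * (ln r - ln P) - ln P).
  rewrite expRB lnK ?posrE// -lnx -powR_expR// powR_mulrn// ltW//.
rewrite (powR_expR _ E0) !(powR_expR _ r0) (powR_expR _ P0) (powR_expR _ x0) lnE lnx.
rewrite [3 `^ _]powR_expR//.
set A := Cg * c * (2 * c) `^ s.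
have A0 : 0 <= A by rewrite /A !mulr_ge0 ?powR_ge0.
rewrite [leLHS](_ : _ = A * (expR (B * ln r) * expR (j%:R * (ln r - ln P) - ln P) *
  expR (s * (j%:R * (ln r - ln P) - ln P - alpha * ln t - sigma / 2 * ln r)))); last first.
  by rewrite /A; ring.
rewrite [leRHS](_ : _ = A * (expR (- alpha * s * ln 3) * expR ((-1 - s - alpha * s) * ln P) *
  expR (b * ln r) * expR (j%:R * (1 + s) * (ln r - ln P)))); last by rewrite /A; ring.
rewrite ler_wpM2l// -!expRD ler_expR.
have lnr0 : 0 <= ln r by rewrite ln_ge0.
have lnt : ln t <= ln 3 + ln P by rewrite -lnM ?posrE// ler_ln ?posrE// mulr_gt0.
rewrite -subr_ge0.
rewrite [leRHS](_ : _ = (- alpha * s) * (ln 3 + ln P - ln t) + (b - (B - sigma / 2 * s)) * ln r); last by ring.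
by rewrite addr_ge0// mulr_ge0// ?subr_ge0// mulr_ge0 ?oppr_ge0// ltW.
Qed.

End remainder.

Section test_function.
Context {R : realType}.
Implicit Types (a b r t : R) (n m l : nat).

Lemma pospow_le1 n (y : R) : y <= 1 -> pospow n y <= 1.
Proof. by move=> y1; rewrite /pospow exprn_ile1// ?le_max ?lexx ?orbT// ge_max y1 ler01. Qed.

Lemma pospow0 n (y : R) : y <= 0 -> pospow n.+1 y = 0.
Proof. by move=> y0; rewrite /pospow max_r// expr0n. Qed.

Lemma pospowS n (y : R) : pospow n.+1 y = Num.max y 0 * pospow n y.
Proof. by rewrite /pospow exprS. Qed.

Lemma pospow_leS n (y : R) : y <= 1 -> pospow n.+1 y <= pospow n y.
Proof. by move=> y1; rewrite pospowS ler_piMl ?pospow_ge0// ge_max y1 ler01. Qed.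

Lemma eta_base_le1 (T t : R) : eta_base T t <= 1 :> R.
Proof. by rewrite /eta_base gerBl sqr_ge0. Qed.

Lemma eta_base_le0 (T t : R) : 0 < T -> ~~ (T <= t <= 3 * T) -> eta_base T t <= 0 :> R.
Proof.
move=> T0; rewrite negb_and -!ltNge /eta_base subr_le0 -real_normK ?num_real// => H.
rewrite exprn_ege1// normrM normfV (gtr0_norm T0) ler_pdivlMr// mul1r ler_normr.
by case/orP: H => H; apply/orP; [right|left]; lra.
Qed.

Lemma chi_base_le1 m (P r : R) : 0 < P -> 1 <= r -> chi_base m P r <= 1 :> R.
Proof.
move=> P0 r1; rewrite /chi_base gerBl exprn_ge0// divr_ge0 ?subr_ge0//.
exact: ltW.
Qed.

Lemma chi_base_le0 m (P r : R) : 0 < P -> 1 + P <= r -> chi_base m P r <= 0 :> R.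
Proof.
move=> P0 r1; rewrite /chi_base subr_le0 exprn_ege1// ler_pdivlMr//; lra.
Qed.

Lemma eta1_bound l (T t : R) : 1 <= T ->
  `|eta1 l.+1 T t| <= 2 * l.+3%:R / T * pospow l.+1 (eta_base T t) :> R.
Proof.
move=> T1; have T0 : 0 < T by exact: lt_le_trans T1.
rewrite /eta1; have [b0|b0] := leP (eta_base T t) 0.
  by rewrite !pospow0// !(mulr0, mul0r) normr0.
have d1 : `|(t - 2 * T) / T| <= 1.
  rewrite leNgt; apply/negP => d1; move: b0; rewrite /eta_base subr_gt0 -real_normK ?num_real//.
  by rewrite ltNge exprn_ege1// ltW.
have pS := pospow_leS l.+1 (eta_base_le1 T t).
rewrite normrM [X in X * _]ger0_norm; last by rewrite mulr_ge0 ?pospow_ge0.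
rewrite normrM (_ : `|- 2 / T| = 2 / T); last first.
  by rewrite mulNr normrN ger0_norm// divr_ge0// ltW.
rewrite [leRHS](_ : _ = (l.+3%:R * pospow l.+1 (eta_base T t)) * (1 * (2 / T))); last by ring.
apply: ler_pM.
- by apply: mulr_ge0 => //; exact: pospow_ge0.
- by apply: mulr_ge0 => //; apply: divr_ge0 => //; exact: ltW.
- by rewrite ler_wpM2l.
- by rewrite ler_wpM2r// divr_ge0// ltW.
Qed.

Lemma outside_support (k n : R) (h h1 : R -> R) m l (P t r : R) : 1 <= P ->
  ~~ ((P <= t <= 3 * P) && (r <= 1 + P)) ->
  [/\ eta l.+1 P t * (h r * chi m l P r) = 0,
      eta1 l.+1 P t * (h r * chi m l P r) = 0 &
      eta l.+1 P t * adjoint_defect k n h h1 m l P r = 0].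
Proof.
move=> P1; have P0 : 0 < P by exact: lt_le_trans P1.
rewrite negb_and => /orP[/(eta_base_le0 P0) b0|].
  by rewrite /eta /eta1 !pospow0// !(mulr0, mul0r).
rewrite -ltNge => /ltW/(chi_base_le0 m P0) w0.
by rewrite /adjoint_defect /chi2 /chi1 /chi !pospow0// !(mulr0, mul0r, addr0).
Qed.

(** The pointwise form of the absorption of u into the source term.  The
    condition on m makes the second remainder increasing in r, hence bounded by
    its value at r = 2P, of order P^b. *)
Lemma test_inequality (p alpha sigma k n B b : R) (h h1 h2 : R -> R) m l :
  1 < p -> alpha <= 0 -> profile k n B h h1 h2 ->
  B - sigma / 2 / (p - 1) <= b ->
  let s := (p - 1)^-1 in
  0 <= b + m.+1%:R * (1 + s) -> l.+3%:R <= p * l.+1%:R ->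
  exists2 C : R, 0 <= C & forall P t r u : R, 1 <= P ->
    P <= t <= 3 * P -> 1 <= r <= 1 + P ->
  `|u| * `|eta1 l.+1 P t * (h r * chi m l P r)| +
  `|u| * `|eta l.+1 P t * adjoint_defect k n h h1 m l P r| <=
  t `^ alpha * r `^ (sigma / 2) * (eta l.+1 P t * (h r * chi m l P r)) * `|u| `^ p +
  C * P `^ (-1 - s - alpha * s) * (r `^ b + P `^ b).
Proof.
move=> p1 al0 hp Bb s bm pl.
have [C0 C00 ratio] := profile_ratio hp; have [Cg Cg0 growth] := profile_growth hp.
have Cc0 : 0 <= adjoint_defect_cst k n C0 m l.
  by rewrite /adjoint_defect_cst !addr_ge0// !mulr_ge0// exprn_ge0.
have [D1 D10 rem1] := @remainder_bound R p alpha sigma B b (2 * l.+3%:R) Cg 0 p1 al0 Bb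
  (mulr_ge0 (ler0n _ 2) (ler0n _ _)) Cg0.
have [D2 D20 rem2] := @remainder_bound R p alpha sigma B b (adjoint_defect_cst k n C0 m l) Cg m.+1
  p1 al0 Bb Cc0 Cg0.
rewrite -/s in rem1 rem2.
exists (D1 + D2 * 2 `^ (b + m.+1%:R * (1 + s))).
  by rewrite addr_ge0// mulr_ge0// powR_ge0.
move=> P t r u P1 tP /andP[r1 rP].
have P0 : 0 < P by exact: lt_le_trans P1.
have t0 : 0 < t by case/andP: tP => + _; exact: lt_le_trans.
have r0 : 0 < r by exact: lt_le_trans r1.
have h0 := profile_ge0 hp r1.
set w := t `^ alpha * r `^ (sigma / 2).
have w0 : 0 < w by rewrite /w mulr_gt0// powR_gt0.
set q := Num.max (eta_base P t) 0; set y := Num.max (chi_base m P r) 0.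
have q0 : 0 <= q by rewrite /q le_max lexx orbT.
have y0 : 0 <= y by rewrite /y le_max lexx orbT.
have q1 : q <= 1 by rewrite /q ge_max eta_base_le1 ler01.
have y1 : y <= 1 by rewrite /y ge_max chi_base_le1// ler01.
have z01 : 0 <= q * y <= 1 by rewrite mulr_ge0//= mulr_ile1.
have phiE : eta l.+1 P t * (h r * chi m l P r) = h r * (q * y) ^+ l.+3.
  by rewrite /eta /chi /pospow -/q -/y exprMn; ring.
pose lam1 := 2 * l.+3%:R / P.
pose lam2 := adjoint_defect_cst k n C0 m l * (r * ((r - 1) / P) ^+ m / P ^+ 2).
have lam10 : 0 <= lam1 by rewrite /lam1 divr_ge0// ltW.
have d0 : 0 <= (r - 1) / P by rewrite divr_ge0 ?subr_ge0// ltW.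
have rd0 : 0 <= r * ((r - 1) / P) ^+ m / P ^+ 2.
  by rewrite divr_ge0 ?mulr_ge0 ?exprn_ge0// ltW.
have lam20 : 0 <= lam2 by rewrite /lam2 mulr_ge0.
have b1 : `|eta1 l.+1 P t * (h r * chi m l P r)| <= h r * lam1 * (q * y) ^+ l.+1.
  rewrite normrM (@ger0_norm _ (h r * _)); last by rewrite mulr_ge0// pospow_ge0.
  rewrite [leRHS](_ : _ = (lam1 * q ^+ l.+1) * (h r * y ^+ l.+1)); last by rewrite exprMn; ring.
  apply: ler_pM => //; first by rewrite mulr_ge0// pospow_ge0.
    exact: eta1_bound.
  rewrite ler_wpM2l// /chi -[leRHS]/(pospow l.+1 (chi_base m P r)).
  by rewrite (le_trans (pospow_leS _ _)) ?chi_base_le1// pospow_leS// chi_base_le1.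
have b2 : `|eta l.+1 P t * adjoint_defect k n h h1 m l P r| <= h r * lam2 * (q * y) ^+ l.+1.
  rewrite normrM (@ger0_norm _ (eta _ _ _)); last exact: pospow_ge0.
  rewrite [leRHS](_ : _ = q ^+ l.+1 * (h r * lam2 * y ^+ l.+1)); last by rewrite exprMn; ring.
  apply: ler_pM => //; first exact: pospow_ge0.
    rewrite /eta -[leRHS]/(pospow l.+1 (eta_base P t)).
    by rewrite (le_trans (pospow_leS _ _)) ?eta_base_le1// pospow_leS// eta_base_le1.
  exact: adjoint_defect_bound (ratio _ r1).
have yg1 := young_test u p1 w0 lam10 h0 z01 pl.
have yg2 := young_test u p1 w0 lam20 h0 z01 pl.
have u0 : 0 <= `|u| by [].
have rr1 := rem1 P t r (h r) lam1 P1 tP r1 h0 (growth r r1) lam10.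
have rr2 := rem2 P t r (h r) lam2 P1 tP r1 h0 (growth r r1) lam20.
rewrite -/w in rr1 rr2.
apply: (@le_trans _ _ (w * (h r * (q * y) ^+ l.+3) * `|u| `^ p +
   (h r * (lam1 * (2 * lam1 / w) `^ s) + h r * (lam2 * (2 * lam2 / w) `^ s)))).
  have := lerD (le_trans (ler_wpM2l u0 b1) yg1) (le_trans (ler_wpM2l u0 b2) yg2).
  by rewrite -/s !addrA; lra.
rewrite phiE lerD2l.
set E := P `^ _.
have E0 : 0 <= E by exact: powR_ge0.
rewrite mul0r powRr0 mulr1 in rr1.
apply: (@le_trans _ _ (D1 * E * r `^ b + D2 * 2 `^ (b + m.+1%:R * (1 + s)) * E * P `^ b)).
  apply: lerD.
    by apply: rr1; rewrite expr0 /lam1 mul1r.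
  apply: (le_trans (rr2 _)).
    rewrite /lam2 ler_wpM2l// (exprS (r / P)).
    rewrite [leLHS](_ : _ = r / P * ((r - 1) / P) ^+ m / P); last first.
      by field; exact: lt0r_neq0.
    rewrite ler_pM2r ?invr_gt0// ler_pM2l ?divr_gt0//.
    rewrite lerXn2r ?nnegrE//; first by rewrite divr_ge0// ltW.
    by rewrite ler_pM2r ?invr_gt0// gerBl.
  have xr : r = P * (r / P) by rewrite mulrC divfK// lt0r_neq0.
  have x0 : 0 < r / P by rewrite divr_gt0.
  have rb : r `^ b = P `^ b * (r / P) `^ b by rewrite {1}xr powRM// ltW.
  rewrite rb -(mulrA (P `^ b)) -powRD; last by rewrite (gt_eqF x0) implybT.
  rewrite [leRHS](_ : _ = D2 * E * (P `^ b * 2 `^ (b + m.+1%:R * (1 + s)))); last by ring.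
  rewrite ler_wpM2l ?mulr_ge0// ler_wpM2l ?powR_ge0//.
  apply: ge0_ler_powR; rewrite ?nnegrE ?(ltW x0)//.
  by rewrite ler_pdivrMr//; lra.
set X := r `^ b; set Y := P `^ b; set Z := 2 `^ _.
have X0 : 0 <= X by exact: powR_ge0.
have Y0 : 0 <= Y by exact: powR_ge0.
have Z0 : 0 <= Z by exact: powR_ge0.
rewrite -subr_ge0 [leRHS](_ : _ = D1 * E * Y + D2 * Z * E * X); last by ring.
by rewrite addr_ge0// !mulr_ge0.
Qed.

End test_function.

(** * Radial solutions of the adjoint equation *)

Section profiles.
Context {R : realType}.
Implicit Types (a b c r t k n : R).

Lemma powRB1 r c : 0 < r -> r `^ (c - 1) = r `^ c / r.
Proof. by move=> r0; rewrite powRB ?powRr1 ?ltW// (gt_eqF r0) implybT. Qed.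

Lemma continuous_powR c r : 0 < r -> {for r, continuous (fun s : R => s `^ c)}.
Proof. by move=> r0; exact: is_derive_continuous (is_derive1_powR c r0). Qed.

Lemma is_derive_cpowR c d r : 0 < r ->
  is_derive r 1 (fun s : R => c * s `^ d) (c * (d * r `^ (d - 1))).
Proof. by move=> r0; exact: is_deriveZ (is_derive1_powR d r0). Qed.

Lemma subr1V_le_ln r : 0 < r -> 1 - r^-1 <= ln r.
Proof.
move=> r0; have rV0 : 0 < r^-1 by rewrite invr_gt0.
have N1 : - 1 < r^-1 - 1 by lra.
have := le_ln1Dx N1; rewrite (_ : 1 + (r^-1 - 1) = r^-1); last by ring.
by rewrite lnV ?posrE//; lra.
Qed.

Definition pow0 c : R -> R := fun r => r `^ c.
Definition pow1 c : R -> R := fun r => c * r `^ (c - 1).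
Definition pow2 c : R -> R := fun r => c * ((c - 1) * r `^ (c - 1 - 1)).

(** The indicial equation (2c - k)(2c + n - 2) = 0 of the adjoint equation, for
    r^c = |x|^(2c). *)
Lemma pow_ode k n c r : 0 < r -> (2 * c - k) * (2 * c + n - 2) = 0 ->
  4 * r * pow2 c r + 2 * (n - k) * pow1 c r - k * (n - 2) * (pow0 c r / r) = 0.
Proof.
move=> r0 E; rewrite /pow0 /pow1 /pow2 !powRB1//.
rewrite [LHS](_ : _ = (2 * c - k) * (2 * c + n - 2) * (r `^ c / r)); last first.
  by field; exact: lt0r_neq0.
by rewrite E mul0r.
Qed.

Lemma pow2_continuous c r : 0 < r -> {for r, continuous (pow2 c)}.
Proof.
move=> r0.
suff : {for r, continuous (fun s : R => c * ((c - 1) * s `^ (c - 1 - 1)))} by [].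
apply: continuousM; first exact: cst_continuous.
by apply: continuousM; [exact: cst_continuous|exact: continuous_powR].
Qed.

Lemma measurable_pow0 c : measurable_fun [set: R] (pow0 c).
Proof. exact: measurable_powR. Qed.

Lemma measurable_pow1 c : measurable_fun [set: R] (pow1 c).
Proof. by apply: measurable_funM => //; exact: measurable_powR. Qed.

Lemma profile_Neumann k n : profile k n (k / 2) (pow0 (k / 2)) (pow1 (k / 2)) (pow2 (k / 2)).
Proof.
split.
- by move=> r r0; exact: is_derive1_powR.
- by move=> r r0; exact: is_derive_cpowR.
- by move=> r; exact: pow2_continuous.
- by move=> r r0; apply: pow_ode => //; field.
- by move=> r _; exact: powR_ge0.
- exists `|k / 2| => // r r1; have r0 : 0 < r by exact: lt_le_trans r1.
  rewrite /pow1 /pow0 normrM (ger0_norm (powR_ge0 _ _)) powRB1//.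
  rewrite [leLHS](_ : _ = `|k / 2| * r `^ (k / 2) * ((r - 1) / r)); last by ring.
  rewrite ler_piMr ?mulr_ge0 ?powR_ge0// ler_pdivrMr// mul1r gerBl//.
- by exists 1 => // r _; rewrite mul1r.
- exact: measurable_pow0.
- exact: measurable_pow1.
Qed.

(** With a = 1 - n/2 and b = k/2, the bound on (r-1) h' comes down to
      (a-b) (1 - 1/r) r^(b-a) <= 1 - r^(b-a),
    which follows from 1 - 1/r <= ln r and from 1 + y <= exp y at y = (a-b) ln r. *)
Lemma profile_Dirichlet k n : k < 2 - n ->
  profile k n (1 - n / 2)
    (fun r => pow0 (1 - n / 2) r - pow0 (k / 2) r)
    (fun r => pow1 (1 - n / 2) r - pow1 (k / 2) r)
    (fun r => pow2 (1 - n / 2) r - pow2 (k / 2) r).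
Proof.
move=> kn; set a := 1 - n / 2; set b := k / 2.
have ab : 0 < a - b by rewrite /a /b; lra.
split.
- by move=> r r0; apply: is_deriveB; exact: is_derive1_powR.
- by move=> r r0; apply: is_deriveB; exact: is_derive_cpowR.
- by move=> r r0; apply: continuousB; exact: pow2_continuous.
- move=> r r0.
  have Ea : 4 * r * pow2 a r + 2 * (n - k) * pow1 a r - k * (n - 2) * (pow0 a r / r) = 0.
    by apply: pow_ode => //; rewrite /a; field.
  have Eb : 4 * r * pow2 b r + 2 * (n - k) * pow1 b r - k * (n - 2) * (pow0 b r / r) = 0.
    by apply: pow_ode => //; rewrite /b; field.
  have := congr2 (fun x y => x - y) Ea Eb; rewrite subrr => <-; ring.
- by move=> r r1; rewrite subr_ge0 ler_powR// -subr_ge0 ltW.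
- exists (`|a| + 1); first by rewrite addr_ge0.
  move=> r r1; have r0 : 0 < r by exact: lt_le_trans r1.
  have y0 : 0 <= ln r by rewrite ln_ge0.
  set e := r `^ (b - a).
  have eE : e = expR (- ((a - b) * ln r)) by rewrite /e powR_expR//; congr expR; ring.
  have e0 : 0 <= e by exact: powR_ge0.
  have e1 : e <= 1 by rewrite eE expR_le1 oppr_le0 mulr_ge0// ltW.
  have bE : r `^ b = r `^ a * e.
    by rewrite /e -powRD; [congr (_ `^ _); ring|rewrite (gt_eqF r0) implybT].
  have key : (a - b) * ln r * e <= 1 - e.
    have : 1 + (a - b) * ln r <= expR ((a - b) * ln r) by rewrite expR_ge1Dx.
    move=> /(ler_wpM2r e0); rewrite {2}eE expRN mulfV ?lt0r_neq0 ?expR_gt0//.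
    by lra.
  rewrite /pow0 /pow1 !powRB1// bE.
  have -> : a * (r `^ a / r) - b * (r `^ a * e / r) = r `^ a / r * (a * (1 - e) + (a - b) * e).
    by ring.
  rewrite normrM ger0_norm ?divr_ge0 ?powR_ge0 ?(ltW r0)//.
  rewrite [leLHS](_ : _ = r `^ a * ((1 - r^-1) * `|a * (1 - e) + (a - b) * e|)); last first.
    by field; exact: lt0r_neq0.
  rewrite [leRHS](_ : _ = r `^ a * ((`|a| + 1) * (1 - e))); last by ring.
  rewrite ler_wpM2l ?powR_ge0//.
  have rV : 0 <= 1 - r^-1 <= 1.
    by rewrite subr_ge0 invf_le1// r1 gerBl invr_ge0 ltW.
  case/andP: rV => rV0 rV1.
  have e1' : 0 <= 1 - e by rewrite subr_ge0.
  have abe : 0 <= (a - b) * e by rewrite mulr_ge0// ltW.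
  apply: (@le_trans _ _ ((1 - r^-1) * (`|a| * (1 - e) + (a - b) * e))).
    rewrite ler_wpM2l// (le_trans (ler_normD _ _))// normrM (ger0_norm e1').
    by rewrite (ger0_norm abe).
  rewrite mulrDr [leRHS]mulrDl mul1r; apply: lerD.
    by rewrite ler_piMl// mulr_ge0.
  apply: le_trans key; rewrite [leRHS](_ : _ = ln r * ((a - b) * e)); last by ring.
  by rewrite ler_wpM2r// subr1V_le_ln.
- by exists 1 => // r _; rewrite mul1r /pow0 gerBl powR_ge0.
- by apply: measurable_funB; exact: measurable_pow0.
- by apply: measurable_funB; exact: measurable_pow1.
Qed.

Definition powln c : R -> R := fun r => r `^ c * ln r.
Definition powln1 c : R -> R := fun r => r `^ (c - 1) * (c * ln r + 1).
Definition powln2 c : R -> R := fun r =>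
  r `^ (c - 1 - 1) * ((c - 1) * (c * ln r + 1) + c).

(** The two exponents coincide, and the second solution carries a logarithm,
    which costs an arbitrarily small power of r. *)
Lemma profile_Dirichlet_log k n eps : k = 2 - n -> 0 < eps ->
  profile k n (1 - n / 2 + eps) (powln (1 - n / 2)) (powln1 (1 - n / 2)) (powln2 (1 - n / 2)).
Proof.
move=> kn eps0; set a := 1 - n / 2.
split.
- move=> r r0; have := is_deriveM (is_derive1_powR a r0) (is_derive1_ln r0).
  rewrite (_ : _ *: _ + _ = powln1 a r)//.
  by rewrite /powln1 /GRing.scale/= powRB1//; ring.
- move=> r r0.
  have d1 : is_derive r 1 (fun s : R => a * ln s + 1) (a * r^-1 + 0).
    exact: (is_deriveD (is_deriveZ a (is_derive1_ln r0)) (is_derive_cst (1 : R) r (1 : R))).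
  have := is_deriveM (is_derive1_powR (a - 1) r0) d1.
  rewrite (_ : _ *: _ + _ = powln2 a r)//.
  by rewrite /powln2 /GRing.scale/= !powRB1//; ring.
- move=> r r0.
  suff : {for r, continuous (fun s : R => s `^ (a - 1 - 1) * ((a - 1) * (a * ln s + 1) + a))} by [].
  apply: continuousM; first exact: continuous_powR.
  apply: continuousD; last exact: cst_continuous.
  apply: continuousM; first exact: cst_continuous.
  apply: continuousD; last exact: cst_continuous.
  by apply: continuousM; [exact: cst_continuous|exact: continuous_ln].
- move=> r r0; rewrite /powln /powln1 /powln2 !powRB1// kn /a.
  by field; exact: lt0r_neq0.
- by move=> r r1; rewrite /powln mulr_ge0 ?powR_ge0// ln_ge0.
- exists (`|a| + 1); first by rewrite addr_ge0.
  move=> r r1; have r0 : 0 < r by exact: lt_le_trans r1.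
  have y0 : 0 <= ln r by rewrite ln_ge0.
  rewrite /powln /powln1 powRB1// normrM ger0_norm ?divr_ge0 ?powR_ge0 ?(ltW r0)//.
  rewrite [leLHS](_ : _ = r `^ a * ((1 - r^-1) * `|a * ln r + 1|)); last first.
    by field; exact: lt0r_neq0.
  rewrite [leRHS](_ : _ = r `^ a * ((`|a| + 1) * ln r)); last by ring.
  rewrite ler_wpM2l ?powR_ge0//.
  have rV : 0 <= 1 - r^-1 <= 1.
    by rewrite subr_ge0 invf_le1// r1 gerBl invr_ge0 ltW.
  case/andP: rV => rV0 rV1.
  apply: (@le_trans _ _ ((1 - r^-1) * (`|a| * ln r + 1))).
    rewrite ler_wpM2l// (le_trans (ler_normD _ _))// normrM (ger0_norm y0).
    by rewrite normr1.
  rewrite mulrDr [leRHS]mulrDl mul1r mulr1; apply: lerD.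
    by rewrite ler_piMl// mulr_ge0.
  by rewrite subr1V_le_ln.
- exists eps^-1; first by rewrite invr_ge0 ltW.
  move=> r r1; have r0 : 0 < r by exact: lt_le_trans r1.
  rewrite /powln [r `^ (a + eps)]powRD; last by rewrite (gt_eqF r0) implybT.
  rewrite mulrCA ler_wpM2l ?powR_ge0// ler_pdivlMl// -ln_powR.
  by apply: ltW; apply: ln_sublinear; rewrite powR_gt0.
- by apply: measurable_funM; [exact: measurable_powR|exact: measurable_ln].
- apply: measurable_funM; first exact: measurable_powR.
  by apply: measurable_funD => //; apply: measurable_funM => //; exact: measurable_ln.
Qed.

End profiles.

(** * Integrals over products and over balls *)

Section tensor.
Context d1 d2 (T1 : measurableType d1) (T2 : measurableType d2) (R : realType).
Variable m1 : {sigma_finite_measure set T1 -> \bar R}.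
Variable m2 : {sigma_finite_measure set T2 -> \bar R}.
Local Open Scope ereal_scope.

Lemma measurable_tensor (e : T1 -> R) (f : T2 -> R) :
  measurable_fun setT e -> measurable_fun setT f ->
  measurable_fun setT (fun z : T1 * T2 => (e z.1 * f z.2)%R).
Proof.
move=> me mf; apply: measurable_funM.
  exact: (measurableT_comp me measurable_fst).
exact: (measurableT_comp mf measurable_snd).
Qed.

Lemma integral_tensor_ge0 (e : T1 -> R) (f : T2 -> R) :
  measurable_fun setT e -> measurable_fun setT f ->
  (forall x, (0 <= e x)%R) -> (forall y, (0 <= f y)%R) ->
  \int[m1 \x m2]_z (e z.1 * f z.2)%:E = (\int[m1]_x (e x)%:E) * \int[m2]_y (f y)%:E.
Proof.
move=> me mf e0 f0.
rewrite fubini_tonelli1; last 2 first.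
  by apply/measurable_EFinP; exact: measurable_tensor.
  by move=> z; rewrite lee_fin mulr_ge0.
rewrite /fubini_F /= -ge0_integralZr//; last 3 first.
  by apply/measurable_EFinP.
  by move=> x _; rewrite lee_fin.
  by apply: integral_ge0 => y _; rewrite lee_fin.
apply: eq_integral => x _; under eq_integral do rewrite EFinM.
rewrite ge0_integralZl_EFin//; last by apply/measurable_EFinP.
by move=> y _; rewrite lee_fin.
Qed.

Lemma integrable_tensor (e : T1 -> R) (f : T2 -> R) :
  m1.-integrable setT (EFin \o e) -> m2.-integrable setT (EFin \o f) ->
  (m1 \x m2).-integrable setT (fun z => (e z.1 * f z.2)%:E).
Proof.
move=> /integrableP[/measurable_EFinP me eoo] /integrableP[/measurable_EFinP mf foo].
apply/integrableP; split; first by apply/measurable_EFinP; exact: measurable_tensor.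
under eq_integral do rewrite abse_EFin normrM.
rewrite (@integral_tensor_ge0 (fun x => `|e x|%R) (fun y => `|f y|%R))//; last 2 first.
  exact: measurableT_comp.
  exact: measurableT_comp.
apply: lte_mul_pinfty => //; first by apply: integral_ge0.
by rewrite ge0_fin_numE//; apply: integral_ge0.
Qed.

Lemma integral_tensor (e : T1 -> R) (f : T2 -> R) :
  m1.-integrable setT (EFin \o e) -> m2.-integrable setT (EFin \o f) ->
  \int[m1 \x m2]_z (e z.1 * f z.2)%:E = (\int[m1]_x (e x)%:E) * \int[m2]_y (f y)%:E.
Proof.
move=> ie jf; rewrite -integral12_prod_meas1; last exact: integrable_tensor.
have If : \int[m2]_y (f y)%:E = (fine (\int[m2]_y (f y)%:E))%:E.
  by rewrite fineK//; exact: integrable_fin_num.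
rewrite If -integralZr//; apply: eq_integral => x _; rewrite /fubini_F/=.
under eq_integral do rewrite EFinM.
by rewrite integralZl// -If.
Qed.

Lemma restrict_tensor (B : set T1) (A : set T2) (e : T1 -> R) (f : T2 -> R) :
  (fun z : T1 * T2 => (e z.1 * f z.2)%:E) \_ (B `*` A) =
  (fun z => ((e \_ B) z.1 * (f \_ A) z.2)%:E).
Proof.
apply/funext => -[x y]; rewrite !patchE /=.
case: ifPn; rewrite in_setX => /=.
  by case/andP => -> ->.
by rewrite negb_and => /orP[/negbTE ->|/negbTE ->]; rewrite ?mul0r ?mulr0.
Qed.

Lemma integral_tensor_setX (B : set T1) (A : set T2) (e : T1 -> R) (f : T2 -> R) :
  measurable B -> measurable A ->
  m1.-integrable B (EFin \o e) -> m2.-integrable A (EFin \o f) ->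
  \int[m1 \x m2]_(z in B `*` A) (e z.1 * f z.2)%:E =
  (\int[m1]_(x in B) (e x)%:E) * \int[m2]_(y in A) (f y)%:E.
Proof.
move=> mB mA ie jf.
rewrite integral_mkcond restrict_tensor integral_tensor; last 2 first.
- by rewrite -restrict_EFin; apply/(integrable_mkcond _ mB).
- by rewrite -restrict_EFin; apply/(integrable_mkcond _ mA).
rewrite [in RHS]integral_mkcond [X in _ = _ * X]integral_mkcond.
by rewrite !restrict_EFin.
Qed.

Lemma integral_tensor_setX_ge0 (B : set T1) (A : set T2) (e : T1 -> R) (f : T2 -> R) :
  measurable B -> measurable A -> measurable_fun B e -> measurable_fun A f ->
  (forall x, (0 <= e x)%R) -> (forall y, (0 <= f y)%R) ->
  \int[m1 \x m2]_(z in B `*` A) (e z.1 * f z.2)%:E =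
  (\int[m1]_(x in B) (e x)%:E) * \int[m2]_(y in A) (f y)%:E.
Proof.
move=> mB mA me mf e0 f0.
rewrite integral_mkcond restrict_tensor integral_tensor_ge0; last 4 first.
- exact/(measurable_restrictT _ mB).
- exact/(measurable_restrictT _ mA).
- by move=> x; rewrite patchE; case: ifP.
- by move=> x; rewrite patchE; case: ifP.
rewrite [in RHS]integral_mkcond [X in _ = _ * X]integral_mkcond.
by rewrite !restrict_EFin.
Qed.

End tensor.

Section balls.
Context {R : realType} {N : nat}.

Lemma measurable_sqnorm : measurable_fun [set: 'rV[R]_N] (@sqnorm R N).
Proof.
apply: measurable_sum => i; apply: measurable_funX; exact: measurable_rV_coord.
Qed.

Definition annulus (a b : R) : set 'rV[R]_N := [set x | a <= sqnorm x <= b].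

Lemma measurable_annulus a b : measurable (annulus a b).
Proof.
have -> : annulus a b = @sqnorm R N @^-1` `[a, b].
  by apply/seteqP; split => x; rewrite /annulus /= in_itv.
by rewrite -[X in measurable X]setTI; apply: measurable_sqnorm.
Qed.

(** Comparison with the cube circumscribed to the ball. *)
Lemma annulus_volume (a b : R) : 0 <= b ->
  (rV_lebesgue (annulus a b) <= (2 ^+ N * b `^ (N%:R / 2))%:E)%E.
Proof.
move=> b0; pose r := Num.sqrt b.
have mI (i : 'I_N) : measurable (`[- r, r]%classic : set R) by [].
apply: (@le_trans _ _ (rV_lebesgue [set x : 'rV[R]_N | forall i, `[- r, r]%classic (x ord0 i)])).
  apply: le_measure; rewrite ?inE; first exact: measurable_annulus.
    have -> : [set x : 'rV[R]_N | forall i, `[- r, r]%classic (x ord0 i)] =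
        \bigcap_(i in setT) (@rV_coord R N i @^-1` `[- r, r]).
      by apply/seteqP; split => x /= H i; [move=> _; exact: H|exact: H].
    apply: fin_bigcap_measurable => // i _.
    by rewrite -[X in measurable X]setTI; apply: measurable_rV_coord.
  move=> x /andP[_ xb] i; rewrite /= in_itv /= -ler_norml.
  by rewrite (le_trans (ler_coord_enorm _ _))// /enorm ler_wsqrtr.
rewrite (@rV_lebesgue_box R N (fun=> `[- r, r]%classic))//.
rewrite (eq_bigr (fun=> (2 * r)%:E)); last first.
  move=> i _; rewrite lebesgue_measure_itv /= lte_fin.
  have r0 : 0 <= r by exact: sqrtr_ge0.
  case: ltP => rr; first by rewrite -EFinB; congr EFin; ring.
  by have -> : r = 0; [lra|rewrite mulr0].
rewrite -(big_morph EFin (@EFinM R) (erefl 1%:E)) prodr_const card_ord lee_fin exprMn ler_wpM2l ?exprn_ge0//.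
by rewrite /r -powR12_sqrt// -powR_mulrn ?powR_ge0// -powRrM [2^-1 * _]mulrC.
Qed.

End balls.

Section dyadic.
Context {R : realType} {N : nat}.

Lemma measurable_sqnorm_powR (b : R) D :
  measurable_fun D (fun x : 'rV[R]_N => (sqnorm x `^ b)%:E).
Proof.
apply/measurable_EFinP; apply: (@measurableT_comp _ _ _ _ _ _ (@powR R ^~ b)); first exact: measurable_powR.
exact: measurable_funTS measurable_sqnorm.
Qed.

(** On a shell A <= r <= 4A the power r^b is comparable to A^b. *)
Lemma shell_integral (b A : R) : 0 < A ->
  (\int[rV_lebesgue]_(x in @annulus R N A (4 * A)) (sqnorm x `^ b)%:E <=
   (2 ^+ N * 4 `^ (N%:R / 2) * 4 `^ `|b| * A `^ (b + N%:R / 2))%:E)%E.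
Proof.
move=> A0; pose M := 4 `^ `|b| * A `^ b.
have M0 : 0 <= M by rewrite mulr_ge0 ?powR_ge0.
apply: (@le_trans _ _ (M%:E * rV_lebesgue (@annulus R N A (4 * A)))%E).
  rewrite -integral_cst; last exact: measurable_annulus.
  apply: ge0_le_integral => //.
  - exact: measurable_annulus.
  - by move=> x _; rewrite lee_fin powR_ge0.
  - exact: measurable_sqnorm_powR.
  move=> x /andP[Ax xA]; rewrite lee_fin /M.
  have x0 : 0 < sqnorm x by exact: lt_le_trans Ax.
  have u1 : 1 <= sqnorm x / A by rewrite ler_pdivlMr// mul1r.
  have -> : sqnorm x `^ b = (sqnorm x / A) `^ b * A `^ b.
    by rewrite -powRM ?divfK ?lt0r_neq0 ?divr_ge0// ltW.
  rewrite ler_wpM2r ?powR_ge0//.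
  apply: (@le_trans _ _ ((sqnorm x / A) `^ `|b|)).
    by rewrite ler_powR// ler_norm.
  apply: ge0_ler_powR; rewrite ?nnegrE ?divr_ge0 ?(ltW A0) ?(ltW x0)//.
  by rewrite ler_pdivrMr.
apply: (@le_trans _ _ (M%:E * (2 ^+ N * (4 * A) `^ (N%:R / 2))%:E)%E).
  by rewrite lee_wpmul2l ?lee_fin// annulus_volume// mulr_ge0// ltW.
rewrite -EFinM lee_fin /M (powRM _ (ler0n R 4) (ltW A0)).
have -> : A `^ (b + N%:R / 2) = A `^ b * A `^ (N%:R / 2).
  by rewrite powRD// (gt_eqF A0) implybT.
by rewrite le_eqVlt; apply/orP; left; apply/eqP; ring.
Qed.

(** Dyadic summation.  The positivity of b + N/2 makes the contributions of the
    shells a geometric series dominated by its last term. *)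
Lemma annulus_integral (b : R) : 0 < b + N%:R / 2 ->
  exists2 C : R, 0 <= C & forall n,
  (\int[rV_lebesgue]_(x in @annulus R N 1 (4 ^+ n)) (sqnorm x `^ b)%:E <=
   (C * (4 ^+ n) `^ (b + N%:R / 2))%:E)%E.
Proof.
set g := b + N%:R / 2 => g0.
pose D : R := 2 ^+ N * 4 `^ (N%:R / 2) * 4 `^ `|b|.
have D0 : 0 <= D by rewrite !mulr_ge0 ?powR_ge0 ?exprn_ge0.
have Q1 : 1 < 4 `^ g :> R.
  have := @gt0_ltr_powR R g g0 1 4; rewrite !nnegrE powR1 => -> //; lra.
have Q10 : 0 < 4 `^ g - 1 :> R by rewrite subr_gt0.
(* If C bounds the ball at scale 4^n and D the next shell, the induction closes when C + D <= C 4^g; the extra D serves n = 0. *)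
exists (D + D / (4 `^ g - 1)); first by rewrite addr_ge0// divr_ge0// ltW.
have f0 (x : 'rV[R]_N) : (0 <= (sqnorm x `^ b)%:E)%E by rewrite lee_fin powR_ge0.
elim => [|n IH].
  apply: (@le_trans _ _ (\int[rV_lebesgue]_(x in @annulus R N 1 (4 * 1)) (sqnorm x `^ b)%:E)%E).
    apply: ge0_subset_integral => //; try exact: measurable_annulus.
      exact: measurable_sqnorm_powR.
    by move=> x /andP[x1 x2]; rewrite /annulus/= x1/= (le_trans x2)// expr0; lra.
  apply: (le_trans (shell_integral b ltr01)).
  by rewrite -/g -/D lee_fin expr0 powR1 !mulr1 lerDl divr_ge0// ltW.
have A0 : 0 < 4 ^+ n :> R by rewrite exprn_gt0.
have sub : @annulus R N 1 (4 ^+ n) `<=` annulus 1 (4 ^+ n.+1).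
  move=> x /andP[x1 x2]; rewrite /annulus/= x1/= (le_trans x2)//.
  by rewrite ler_eXn2l// ; lra.
rewrite -(setDUK sub) ge0_integral_setU//; last 4 first.
- exact: measurable_annulus.
- by apply: measurableD; exact: measurable_annulus.
- exact: measurable_sqnorm_powR.
- by rewrite disj_set2E setDIK.
apply: (@le_trans _ _ (((D + D / (4 `^ g - 1)) * (4 ^+ n) `^ g)%:E +
   (D * (4 ^+ n) `^ g)%:E)%E).
  apply: leeD => //; apply: le_trans (shell_integral b A0).
  apply: ge0_subset_integral => //.
  - by apply: measurableD; exact: measurable_annulus.
  - exact: measurable_annulus.
  - exact: measurable_sqnorm_powR.
  move=> x [/andP[x1 x2]] /negP; rewrite x1/= -ltNge => /ltW x3.
  by rewrite /annulus/= x3/= -exprS.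
rewrite -EFinD lee_fin exprS (powRM g (ler0n R 4) (ltW A0)).
have X0 : 0 <= (4 ^+ n) `^ g :> R by exact: powR_ge0.
rewrite -mulrDl mulrA ler_wpM2r// -subr_ge0.
rewrite [leRHS](_ : _ = D * (4 `^ g - 1)); first by rewrite mulr_ge0// ltW.
by field; exact: lt0r_neq0.
Qed.

End dyadic.

(** * The test functions *)

Section test_functions.
Context {R : realType} {N : nat}.
Variables (k B : R) (h h1 h2 : R -> R).
Hypothesis hp : profile k N%:R B h h1 h2.
Variables (m l : nat) (P : R).
Hypothesis P1 : 1 <= P.

Let P0 : 0 < P. Proof. exact: lt_le_trans P1. Qed.

Definition cutprofile (h : R -> R) m l P r : R := h r * chi m l P r.

Definition testfun (h : R -> R) m l P : R * 'rV[R]_N -> R :=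
  radial (eta l.+1 P) (cutprofile h m l P).

Let cutprofile1 r : R := h1 r * chi m l P r + h r * chi1 m l P r.
Let cutprofile2 r : R := h2 r * chi m l P r + 2 * h1 r * chi1 m l P r + h r * chi2 m l P r.

Let is_derive_cutprofile (r : R) : 0 < r -> is_derive r 1 (cutprofile h m l P) (cutprofile1 r).
Proof.
move=> r0; have := is_deriveM (profile_der hp r0) (is_derive_chi m l P r).
rewrite (_ : _ *: _ + _ = cutprofile1 r)//.
by rewrite /cutprofile1 /GRing.scale/=; ring.
Qed.

Let is_derive_cutprofile1 (r : R) : 0 < r -> is_derive r 1 cutprofile1 (cutprofile2 r).
Proof.
move=> r0; have := is_deriveD
  (is_deriveM (profile_der1 hp r0) (is_derive_chi m l P r))
  (is_deriveM (profile_der hp r0) (is_derive_chi1 m l P r)).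
rewrite (_ : _ *: _ + _ + _ = cutprofile2 r)//.
by rewrite /cutprofile2 /GRing.scale/=; ring.
Qed.

Let cutprofile2_continuous (r : R) : 0 < r -> {for r, continuous cutprofile2}.
Proof.
move=> r0.
have ch := is_derive_continuous (profile_der hp r0).
have ch1 := is_derive_continuous (profile_der1 hp r0).
have cx := is_derive_continuous (is_derive_chi m l P r).
have cx1 := is_derive_continuous (is_derive_chi1 m l P r).
have cx2 := @chi2_continuous R m l P r.
suff : {for r, continuous (fun r : R => h2 r * chi m l P r + 2 * h1 r * chi1 m l P r
   + h r * chi2 m l P r)} by [].
apply: continuousD; last exact: continuousM.
apply: continuousD; first by apply: continuousM => //; exact: (profile_cont hp).
by apply: continuousM => //; apply: continuousM => //; exact: cst_continuous.
Qed.

Lemma C12_testfun : C12 (testfun h m l P).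
Proof.
apply: (@C12_radial _ _ _ (eta1 l.+1 P) _ cutprofile1 cutprofile2) => //.
- by move=> t; exact: is_derive_eta.
- exact: eta1_continuous.
Qed.

Lemma dt_testfun z : dt (testfun h m l P) z = eta1 l.+1 P z.1 * cutprofile h m l P (sqnorm z.2).
Proof. exact: (dt_radial _ (is_derive_eta l.+1 P) z). Qed.

Lemma adjoint_testfun z : 0 < sqnorm z.2 ->
  - laplacian (testfun h m l P) z + k * div_drift (testfun h m l P) z =
  - (eta l.+1 P z.1 * adjoint_defect k N%:R h h1 m l P (sqnorm z.2)).
Proof.
move=> z0.
rewrite /testfun (laplacian_radial _ is_derive_cutprofile is_derive_cutprofile1)//.
rewrite (div_drift_radial _ is_derive_cutprofile)//.
rewrite /adjoint_defect /cutprofile2 /cutprofile1 /cutprofile.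
set r := sqnorm z.2; have ode := profile_ode hp z0; rewrite -/r in ode.
set E := eta _ _ _; set X := chi m l P r.
(* Multiplied by - eta chi, the equation for h cancels every term in which chi is not differentiated. *)
have := congr1 (fun x => - E * X * x) ode.
rewrite /= mulr0 => ode'.
rewrite -[RHS]addr0 -[X in _ = _ + X]ode'; field; exact: lt0r_neq0.
Qed.

Lemma testfun_ge0 z : 1 <= sqnorm z.2 -> 0 <= testfun h m l P z.
Proof.
move=> z1; apply: mulr_ge0; first exact: pospow_ge0.
by apply: mulr_ge0; [exact: (profile_ge0 hp)|exact: pospow_ge0].
Qed.

Lemma dnu_testfun z : usphere z.2 -> dnu (testfun h m l P) z = - (2 * h1 1) * eta l.+1 P z.1.
Proof.
move=> z1; rewrite /testfun (dnu_radial _ is_derive_cutprofile)//.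
by rewrite /cutprofile1 chi_1 chi1_1; ring.
Qed.

Lemma testfun_sphere z : usphere z.2 -> testfun h m l P z = h 1 * eta l.+1 P z.1.
Proof. by move=> /usphere_sqnorm z1; rewrite /testfun /radial z1 /cutprofile chi_1; ring. Qed.

(** Support of the test function at scale P, in terms of t and |x|^2. *)
Definition cylinder (P : R) : set (R * 'rV[R]_N) := `[P, 3 * P] `*` annulus 1 (1 + P).

Lemma cylinder_Omega : cylinder P `<=` Omega.
Proof.
move=> z [/= + /andP[z1 _]]; rewrite in_itv/= => /andP[tP _].
by split; [exact: lt_le_trans tP|rewrite enorm_ge1].
Qed.

Lemma measurable_cylinder : measurable (cylinder P : set (measurableTypeR R * 'rV[R]_N)).
Proof. by apply: measurableX; [exact: measurable_itv|exact: measurable_annulus]. Qed.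

Lemma compact_cylinder : compact (cylinder P).
Proof.
apply: compact_setX; first exact: segment_compact.
pose r := Num.sqrt (1 + P).
apply: (subclosed_compact _ (@rV_compact _ N (fun=> `[- r, r]%classic) _)).
- have -> : annulus 1 (1 + P) = @sqnorm R N @^-1` `[1, 1 + P].
    by apply/seteqP; split => x; rewrite /annulus /= in_itv.
  apply: closed_comp; last exact: interval_closed.
  by move=> x _; exact: continuous_sqnorm.
- by move=> i; exact: segment_compact.
move=> x /andP[_ xb] i; rewrite /= in_itv /= -ler_norml.
by rewrite (le_trans (ler_coord_enorm _ _))// /enorm ler_wsqrtr.
Qed.

Lemma closed_cylinder : closed (cylinder P).
Proof. by apply: compact_closed; [exact: norm_hausdorff|exact: compact_cylinder]. Qed.

Lemma off_cylinder z : Omega z -> ~ cylinder P z ->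
  ~~ ((P <= z.1 <= 3 * P) && (sqnorm z.2 <= 1 + P)).
Proof.
move=> [_]; rewrite enorm_ge1 => z1 nK; apply/negP => /andP[tP rP].
by apply: nK; split; rewrite /annulus/= ?in_itv//= z1.
Qed.

(** The test function vanishes on [Omega] off the compact set [cylinder P]. *)
Lemma compactly_supported_testfun : compactly_supported (testfun h m l P).
Proof.
have sub : closure (Omega `&` [set z | testfun h m l P z != 0]) `<=` cylinder P.
  rewrite [X in _ `<=` X](closure_id _).1; last exact: closed_cylinder.
  apply: closure_subset => z [Oz /= /eqP z0]; apply: contrapT => nK; apply: z0.
  by have [] := outside_support 0 0 h h m l P1 (off_cylinder Oz nK).
split; last exact: (subset_trans sub cylinder_Omega).
by apply: (subclosed_compact _ compact_cylinder) => //; exact: closed_closure.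
Qed.

End test_functions.

(** * The boundary term *)

Section integrals.
Context {R : realType} {N : nat}.
Local Open Scope ereal_scope.

Lemma integral_support d (T : measurableType d) (mu : {measure set T -> \bar R}) (D K : set T)
    (F : T -> \bar R) :
  K `<=` D -> (forall z, D z -> ~ K z -> F z = 0) ->
  \int[mu]_(z in D) F z = \int[mu]_(z in K) F z.
Proof.
move=> KD F0; rewrite -[in RHS](setIidr KD) integral_mkcondr.
apply: eq_integral => z /set_mem Dz; rewrite patchE.
by case: ifPn => // /negP zK; apply: F0 => // Kz; apply: zK; exact: mem_set.
Qed.

Lemma measurable_eta l (P : R) : measurable_fun [set: R] (@eta R l P).
Proof. by apply: continuous_measurable_fun => t; exact: is_derive_continuous (is_derive_eta l P t). Qed.

Lemma eta_le1 l (P t : R) : (eta l P t <= 1)%R.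
Proof. by apply: pospow_le1; exact: eta_base_le1. Qed.

Lemma eta_ge0 l (P t : R) : (0 <= eta l P t)%R.
Proof. exact: pospow_ge0. Qed.

Lemma measurable_eta1 l (P : R) : measurable_fun [set: R] (@eta1 R l P).
Proof. by apply: continuous_measurable_fun; exact: eta1_continuous. Qed.

Definition eta_mass l (P : R) : R := fine (\int[lebesgue_measure]_(t in `[P, (3 * P)%R]) (eta l P t)%:E).

Lemma integrable_eta l (P : R) :
  (@lebesgue_measure R).-integrable `[P, (3 * P)%R] (EFin \o eta l P).
Proof.
apply: continuous_compact_integrable; first exact: segment_compact.
apply: continuous_subspaceT => t; exact: is_derive_continuous (is_derive_eta l P t).
Qed.

(** On the middle half of its support, the base of eta is at least 3/4. *)
Lemma eta_mass_ge l (P : R) : (0 < P)%R -> ((3 / 4) ^+ l.+2 * P <= eta_mass l P)%R.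
Proof.
move=> P0; rewrite -lee_fin /eta_mass fineK; last exact: integrable_fin_num (integrable_eta l P).
have PP : (3 / 2 * P < 5 / 2 * P)%R by rewrite ltr_pM2r//; lra.
apply: (@le_trans _ _ (\int[lebesgue_measure]_(t in `[(3 / 2 * P)%R, (5 / 2 * P)%R]) (eta l P t)%:E)); last first.
  apply: ge0_subset_integral => //.
  - by apply/measurable_EFinP; apply: measurable_funTS; exact: measurable_eta.
  - by move=> t _; rewrite lee_fin eta_ge0.
  by move=> t; rewrite /= !in_itv/= => /andP[a b]; apply/andP; split; lra.
apply: (@le_trans _ _ (\int[lebesgue_measure]_(t in `[(3 / 2 * P)%R, (5 / 2 * P)%R]) (cst ((3 / 4) ^+ l.+2)%:E t))).
  rewrite integral_cst//= lebesgue_measure_itv/= lte_fin PP -EFinB -EFinM lee_fin.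
  by rewrite -mulrBl (_ : 5 / 2 - 3 / 2 = 1)%R ?mul1r//; field.
apply: ge0_le_integral => //.
- by move=> t _; rewrite lee_fin exprn_ge0// divr_ge0.
- by apply/measurable_EFinP; apply: measurable_funTS; exact: measurable_eta.
move=> t; rewrite /= in_itv/= => /andP[a b]; rewrite lee_fin /eta /pospow.
have q34 : (3 / 4 <= eta_base P t)%R.
  have d1 : (`|(t - 2 * P) / P| <= 1 / 2)%R.
    by rewrite normrM normfV (gtr0_norm P0) ler_pdivrMr// ler_norml; apply/andP; split; lra.
  have : (((t - 2 * P) / P) ^+ 2 <= (1 / 2) ^+ 2)%R.
    by rewrite -real_normK ?num_real// lerXn2r// nnegrE; lra.
  by rewrite /eta_base; lra.
by rewrite lerXn2r ?nnegrE ?le_max ?q34//; lra.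
Qed.

Lemma measurable_usphere : measurable (@usphere R N).
Proof.
have -> : @usphere R N = @enorm R N @^-1` [set 1%R] by [].
by rewrite -[X in measurable X]setTI; apply: measurable_enorm.
Qed.

(** Both boundary conditions make the boundary datum of the test function a
    function of t alone, so that the lateral integral is a product. *)
Lemma boundary_integral (f : 'rV[R]_N -> R) (X : R * 'rV[R]_N -> R) (c : R) l (P : R) :
  (0 < P)%R -> (@sphere_measure R N).-integrable usphere (EFin \o f) ->
  (forall z, Gamma z -> X z = (c * eta l.+1 P z.1)%R) ->
  \int[lateral]_(z in Gamma) (f z.2 * X z)%:E =
  (c * eta_mass l.+1 P)%:E * \int[sphere_measure]_(x in usphere) (f x)%:E.
Proof.
move=> P0 jf XE.
pose K : set (measurableTypeR R * 'rV[R]_N) := `[P, (3 * P)%R] `*` usphere.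
have KG : K `<=` Gamma.
  move=> z [/=]; rewrite in_itv/= => /andP[a b] s; split => //.
  exact: lt_le_trans a.
rewrite /lateral (@integral_support _ _ _ _ K)//; last first.
  move=> z Gz nK; rewrite XE// /eta pospow0 ?mulr0//.
  apply: eta_base_le0 => //; apply/negP => a; apply: nK; split.
    by rewrite /= in_itv.
  by case: Gz.
transitivity (\int[(@lebesgue_measure R \x @sphere_measure R N)]_(z in K)
    ((c * eta l.+1 P z.1) * f z.2)%:E).
  by apply: eq_integral => z /set_mem/KG Gz; rewrite XE// mulrC.
have ie' : (@lebesgue_measure R).-integrable `[P, (3 * P)%R] (EFin \o (fun t => c * eta l.+1 P t)%R).
  apply: continuous_compact_integrable; first exact: segment_compact.
  apply: continuous_subspaceT => t; apply: continuousM; first exact: cst_continuous.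
  exact: is_derive_continuous (is_derive_eta l.+1 P t).
have H := @integral_tensor_setX _ _ _ _ R (@lebesgue_measure R) (@sphere_measure R N)
  `[P, (3 * P)%R]%classic usphere (fun t => (c * eta l.+1 P t)%R) f
  (measurable_itv _) measurable_usphere ie' jf.
apply: (etrans H).
congr (_ * _); under eq_integral do rewrite EFinM.
rewrite integralZl//; last exact: integrable_eta.
rewrite EFinM /eta_mass fineK//; exact: integrable_fin_num (integrable_eta _ _).
Qed.

End integrals.

(** * The interior terms *)

Section interior.
Context {R : realType} {N : nat}.
Local Open Scope ereal_scope.

Let X := (measurableTypeR R * 'rV[R]_N)%type.

Lemma measurable_radius (D : set X) (g : R -> R) : measurable_fun [set: R] g ->
  measurable_fun D (fun z : X => g (sqnorm z.2)).
Proof.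
move=> mg; apply: measurable_funTS.
apply: (@measurableT_comp _ _ _ _ _ _ g) => //.
exact: (@measurableT_comp _ _ _ _ _ _ (@sqnorm R N) _ _ measurable_sqnorm measurable_snd).
Qed.

Lemma measurable_time (D : set X) (g : R -> R) : measurable_fun [set: R] g ->
  measurable_fun D (fun z : X => g z.1).
Proof.
move=> mg; apply: measurable_funTS.
exact: (@measurableT_comp _ _ _ _ _ _ g _ _ mg measurable_fst).
Qed.

Lemma measurable_chi m l (P : R) : measurable_fun [set: R] (chi m l P).
Proof.
by apply: continuous_measurable_fun => t; exact: is_derive_continuous (is_derive_chi m l P t).
Qed.

Lemma measurable_adjoint_defect (k n : R) (h h1 : R -> R) m l (P : R) :
  measurable_fun [set: R] h -> measurable_fun [set: R] h1 ->
  measurable_fun [set: R] (adjoint_defect k n h h1 m l P).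
Proof.
move=> mh mh1.
have m1 : measurable_fun [set: R] (chi1 m l P).
  by apply: continuous_measurable_fun => t; exact: is_derive_continuous (is_derive_chi1 m l P t).
have m2 : measurable_fun [set: R] (chi2 m l P).
  by apply: continuous_measurable_fun; exact: chi2_continuous.
apply: measurable_funD.
  apply: measurable_funM; first exact: measurable_funM.
  apply: measurable_funD; last exact: measurable_funM.
  by apply: measurable_funM => //; exact: measurable_funM.
by apply: measurable_funM => //; exact: measurable_funM.
Qed.

Lemma enorm_powR (sigma : R) (x : 'rV[R]_N) : (enorm x `^ sigma = sqnorm x `^ (sigma / 2))%R.
Proof.
by rewrite /enorm -/(sqnorm x) -powR12_sqrt ?sqnorm_ge0// -powRrM mulrC.
Qed.

(** Integral of the remainder of [test_inequality] over the support: length 2P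
    in time, and [annulus_integral] in space after enlarging 1 + P to 4P. *)
Lemma cylinder_remainder (b Cst : R) n : (0 <= Cst)%R -> (0 < b + N%:R / 2)%R ->
  forall C1 : R,
  (forall n, \int[rV_lebesgue]_(x in @annulus R N 1 (4 ^+ n)) (sqnorm x `^ b)%:E <=
    (C1 * (4 ^+ n) `^ (b + N%:R / 2))%:E) ->
  forall P : R, P = (4 ^+ n)%R ->
  \int[volume]_(z in @cylinder R N P) (Cst * (sqnorm z.2 `^ b + P `^ b))%:E <=
  (2 * P * Cst * ((C1 * 4 `^ (b + N%:R / 2) + 2 ^+ N * 4 `^ (N%:R / 2)) * P `^ (b + N%:R / 2)))%:E.
Proof.
set g := (b + N%:R / 2)%R => C0 g0 C1 HC1 P PE.
have P0 : (0 < P)%R by rewrite PE exprn_gt0.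
have P1 : (1 <= P)%R by rewrite PE exprn_ege1//; lra.
pose fG (x : 'rV[R]_N) : R := (Cst * (sqnorm x `^ b + P `^ b))%R.
have fG0 x : (0 <= fG x)%R by rewrite /fG mulr_ge0// addr_ge0// powR_ge0.
have mfG D : measurable_fun D fG.
  apply: measurable_funM => //; apply: measurable_funD => //.
  by apply/measurable_EFinP; exact: measurable_sqnorm_powR.
have H := @integral_tensor_setX_ge0 _ _ _ _ R (@lebesgue_measure R) (@rV_lebesgue R N)
  `[P, (3 * P)%R]%classic (annulus 1 (1 + P)) (cst 1%R) fG (measurable_itv _)
  (measurable_annulus _ _) (measurable_cst _) (mfG _) (fun=> ler01) fG0.
rewrite (_ : \int[volume]_(z in @cylinder R N P) _ =
  \int[lebesgue_measure \x rV_lebesgue]_(z in `[P, (3 * P)%R]%classic `*` annulus 1 (1 + P))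
     (cst 1%R z.1 * fG z.2)%:E); last first.
  by apply: eq_integral => z _; rewrite /cst mul1r.
rewrite H; clear H.
have -> : \int[lebesgue_measure]_(x in `[P, (3 * P)%R]) (cst 1%R x)%:E = (2 * P)%:E :> \bar R.
  rewrite (_ : (fun x => _) = cst 1%:E)// integral_cst//= lebesgue_measure_itv/= lte_fin.
  rewrite ifT; last by lra.
  by rewrite mul1e -EFinB; congr EFin; ring.
rewrite -[X in _ <= X%:E]mulrA [leRHS]EFinM lee_wpmul2l ?lee_fin ?mulr_ge0 ?(ltW P0)//.
have mA := @measurable_annulus R N 1 (1 + P).
have -> : \int[rV_lebesgue]_(x in annulus 1 (1 + P)) (fG x)%:E =
    Cst%:E * (\int[rV_lebesgue]_(x in @annulus R N 1 (1 + P)) (sqnorm x `^ b)%:E +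
              (P `^ b)%:E * rV_lebesgue (@annulus R N 1 (1 + P))).
  under eq_integral do rewrite EFinM EFinD.
  rewrite ge0_integralZl_EFin//; last 2 first.
  - by move=> x _; rewrite -EFinD lee_fin addr_ge0// powR_ge0.
  - by apply: emeasurable_funD => //; exact: measurable_sqnorm_powR.
  congr (_ * _); rewrite ge0_integralD//; last 3 first.
  - by move=> x _; rewrite lee_fin powR_ge0.
  - exact: measurable_sqnorm_powR.
  - by move=> x _; rewrite lee_fin powR_ge0.
  by congr (_ + _); rewrite -integral_cst.
rewrite [leRHS]EFinM lee_wpmul2l ?lee_fin// mulrDl EFinD; apply: leeD.
  apply: (@le_trans _ _ (\int[rV_lebesgue]_(x in @annulus R N 1 (4 ^+ n.+1)) (sqnorm x `^ b)%:E)).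
    apply: ge0_subset_integral => //.
    - exact: measurable_annulus.
    - exact: measurable_sqnorm_powR.
    - by move=> x _; rewrite lee_fin powR_ge0.
    move=> x /andP[x1 x2]; rewrite /annulus/= x1/= (le_trans x2)// exprS -PE; lra.
  by rewrite (le_trans (HC1 _))// lee_fin exprS -PE (powRM _ (ler0n R 4) (ltW P0)) mulrA.
have P40 : (0 <= 4 * P)%R by rewrite mulr_ge0// ltW.
apply: (@le_trans _ _ ((P `^ b)%:E * (2 ^+ N * (4 * P) `^ (N%:R / 2))%:E)).
  rewrite lee_wpmul2l ?lee_fin ?powR_ge0//.
  apply: le_trans (annulus_volume 1 P40); apply: le_measure; rewrite ?inE//.
    exact: measurable_annulus.
  by move=> x /andP[x1 x2]; rewrite /annulus/= x1/= (le_trans x2)//; lra.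
rewrite -EFinM lee_fin (powRM _ (ler0n R 4) (ltW P0)) /g.
have -> : (P `^ (b + N%:R / 2) = P `^ b * P `^ (N%:R / 2))%R.
  by rewrite powRD// (gt_eqF P0) implybT.
by rewrite le_eqVlt; apply/orP; left; apply/eqP; ring.
Qed.

End interior.

Section interior.
Context {R : realType} {N : nat}.
Variables (k sigma alpha p B b : R) (h h1 h2 : R -> R) (m l : nat).
Hypothesis hp : profile k N%:R B h h1 h2.
Variable u : R * 'rV[R]_N -> R.
Hypothesis hu : Lp_loc p u.

Let X := (measurableTypeR R * 'rV[R]_N)%type.

Section fixed_scale.
Variable P : R.
Hypothesis P1 : 1 <= P.

Let K : set X := @cylinder R N P.
Let phi := @testfun R N h m l P.
Let S (z : X) := z.1 `^ alpha * enorm z.2 `^ sigma * `|u z| `^ p * phi z.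
Let F1 (z : X) := u z * (eta1 l.+1 P z.1 * cutprofile h m l P (sqnorm z.2)).
Let F2 (z : X) :=
  - (eta l.+1 P z.1 * adjoint_defect k N%:R h h1 m l P (sqnorm z.2)) * u z.

Let mK : measurable K. Proof. exact: measurable_cylinder. Qed.

Let mu : measurable_fun K u.
Proof.
apply: measurable_funS hu.1; first exact: measurable_Omega.
exact: cylinder_Omega.
Qed.

Let mcutprofile : measurable_fun [set: R] (cutprofile h m l P).
Proof. by apply: measurable_funM; [exact: profile_meas hp|exact: measurable_chi]. Qed.

Let mS : measurable_fun K S.
Proof.
apply: measurable_funM.
  apply: measurable_funM.
    apply: measurable_funM; first exact: (measurable_time (@measurable_powR R alpha)).
    rewrite (_ : (fun z : X => enorm z.2 `^ sigma) = (fun z : X => sqnorm z.2 `^ (sigma / 2))).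
      exact: (measurable_radius (@measurable_powR R (sigma / 2))).
    by apply/funext => z; rewrite enorm_powR.
  apply: (@measurableT_comp _ _ _ _ _ _ (@powR R ^~ p)); first exact: measurable_powR.
  exact: measurableT_comp.
apply: measurable_funM; first exact: (measurable_time (measurable_eta _ _)).
exact: (measurable_radius mcutprofile).
Qed.

Let mF1 : measurable_fun K F1.
Proof.
apply: measurable_funM => //.
apply: measurable_funM; first exact: (measurable_time (measurable_eta1 _ _)).
exact: (measurable_radius mcutprofile).
Qed.

Let mF2 : measurable_fun K F2.
Proof.
apply: measurable_funM => //; apply: measurableT_comp => //.
apply: measurable_funM; first exact: (measurable_time (measurable_eta _ _)).
apply: measurable_radius; apply: measurable_adjoint_defect.
- exact: profile_meas hp.
- exact: profile_meas1 hp.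
Qed.

Let out z : Omega z -> ~ K z ->
  [/\ eta l.+1 P z.1 * cutprofile h m l P (sqnorm z.2) = 0,
      eta1 l.+1 P z.1 * cutprofile h m l P (sqnorm z.2) = 0 &
      eta l.+1 P z.1 * adjoint_defect k N%:R h h1 m l P (sqnorm z.2) = 0].
Proof. by move=> Oz nK; apply: outside_support => //; exact: off_cylinder. Qed.

Lemma sourceE : source alpha sigma p u phi = (\int[volume]_(z in K) (S z)%:E)%E.
Proof.
rewrite /source /volume (@integral_support _ _ _ _ _ K)//; first exact: cylinder_Omega.
move=> z Oz nK; rewrite /phi /testfun /radial.
by have [-> _ _] := out Oz nK; rewrite mulr0.
Qed.

Lemma adjointE : adjoint k u phi =
  (- (\int[volume]_(z in K) (F1 z)%:E) + \int[volume]_(z in K) (F2 z)%:E)%E.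
Proof.
have dtE z : u z * dt phi z = F1 z by rewrite /phi dt_testfun.
have O0 (z : R * 'rV[R]_N) : Omega z -> 0 < sqnorm z.2.
  by case=> _; rewrite enorm_ge1; exact: lt_le_trans.
rewrite /adjoint /volume; congr (- _ + _)%E.
  rewrite (@integral_support _ _ _ _ _ K); first last.
  - move=> z Oz nK; rewrite dtE /F1.
    by have [_ -> _] := out Oz nK; rewrite mulr0.
  - exact: cylinder_Omega.
  by apply: eq_integral => z _; rewrite dtE.
rewrite (@integral_support _ _ _ _ _ K); first last.
- move=> z Oz nK; rewrite (adjoint_testfun hp _ _ _ (O0 _ Oz)).
  by have [_ _ ->] := out Oz nK; rewrite oppr0 mul0r.
- exact: cylinder_Omega.
apply: eq_integral => z /set_mem Kz; rewrite (adjoint_testfun hp)//.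
by apply: O0; exact: cylinder_Omega Kz.
Qed.

Let KE z : K z -> P <= z.1 <= 3 * P /\ 1 <= sqnorm z.2 <= 1 + P.
Proof. by move=> [/=]; rewrite in_itv/=. Qed.

Let S0 z : K z -> 0 <= S z.
Proof.
move=> /KE[_ /andP[z1 _]]; apply: mulr_ge0; first by rewrite !mulr_ge0 ?powR_ge0.
exact: (testfun_ge0 hp).
Qed.

(** Finiteness of the source term, which is needed to cancel it from both sides
    of the inequality, holds since phi is bounded with compact support. *)
Lemma source_lty : alpha <= 0 -> (source alpha sigma p u phi < +oo)%E.
Proof.
move=> al0; rewrite sourceE.
have [Cg Cg0 growth] := profile_growth hp.
pose M := (1 + P) `^ (`|sigma / 2|) * (Cg * (1 + P) `^ `|B|).
have M0 : 0 <= M by rewrite !mulr_ge0 ?powR_ge0.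
have mup : measurable_fun K (fun z => (`|u z| `^ p)%:E).
  apply/measurable_EFinP; apply: (@measurableT_comp _ _ _ _ _ _ (@powR R ^~ p)).
    exact: measurable_powR.
  exact: measurableT_comp.
apply: (@le_lt_trans _ _ (\int[volume]_(z in K) (M%:E * (`|u z| `^ p)%:E))%E).
  rewrite /volume; apply: ge0_le_integral => //.
  - exact/measurable_EFinP.
  - exact: measurable_funeM.
  move=> z Kz; have [/andP[tP _] /andP[r1 rP]] := KE Kz.
  rewrite -EFinM lee_fin /S enorm_powR [leLHS]mulrAC ler_wpM2r ?powR_ge0//.
  have pwb (c : R) : sqnorm z.2 `^ c <= (1 + P) `^ `|c|.
    apply: (@le_trans _ _ (sqnorm z.2 `^ `|c|)); first by rewrite ler_powR// ler_norm.
    have P10 : 0 <= 1 + P by rewrite (le_trans _ rP)// sqnorm_ge0.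
    by apply: ge0_ler_powR; rewrite ?nnegrE ?sqnorm_ge0.
  have t1 : z.1 `^ alpha <= 1.
    by rewrite -(powRr0 z.1) ler_powR// (le_trans P1).
  have phib : phi z <= Cg * (1 + P) `^ `|B|.
    rewrite /phi /testfun /radial /cutprofile -[leRHS]mul1r; apply: ler_pM.
    - exact: eta_ge0.
    - by apply: mulr_ge0; [exact: (profile_ge0 hp)|exact: pospow_ge0].
    - exact: eta_le1.
    rewrite -[leRHS]mulr1; apply: ler_pM; rewrite ?pospow_ge0//.
    - exact: (profile_ge0 hp).
    - by rewrite (le_trans (growth _ r1))// ler_wpM2l.
    by apply: pospow_le1; rewrite chi_base_le1// (lt_le_trans ltr01).
  rewrite /M -mulrA -[leRHS]mul1r; apply: ler_pM => //; rewrite ?powR_ge0//.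
    by apply: mulr_ge0; [exact: powR_ge0|exact: (testfun_ge0 hp)].
  by apply: ler_pM => //; [exact: powR_ge0|exact: (testfun_ge0 hp)].
rewrite /volume ge0_integralZl_EFin//.
apply: lte_mul_pinfty; rewrite ?lee_fin//.
by apply: hu.2; [exact: compact_cylinder|exact: cylinder_Omega].
Qed.

Lemma adjoint_le (Cst : R) : 0 <= Cst ->
  (forall t r v : R, P <= t <= 3 * P -> 1 <= r <= 1 + P ->
  `|v| * `|eta1 l.+1 P t * (h r * chi m l P r)| +
  `|v| * `|eta l.+1 P t * adjoint_defect k N%:R h h1 m l P r| <=
  t `^ alpha * r `^ (sigma / 2) * (eta l.+1 P t * (h r * chi m l P r)) * `|v| `^ p +
  Cst * (r `^ b + P `^ b)) ->
  (adjoint k u phi <= source alpha sigma p u phi +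
    \int[volume]_(z in K) (Cst * (sqnorm z.2 `^ b + P `^ b))%:E)%E.
Proof.
move=> C0 H; rewrite adjointE sourceE.
have mG : measurable_fun K (fun z => (Cst * (sqnorm z.2 `^ b + P `^ b))%:E).
  apply/measurable_EFinP; apply: measurable_funM => //; apply: measurable_funD => //.
  exact: (measurable_radius (@measurable_powR R b)).
have G0 z : 0 <= Cst * (sqnorm z.2 `^ b + P `^ b) by rewrite mulr_ge0// addr_ge0// powR_ge0.
have mnF1 : measurable_fun K (fun z => `|F1 z|%:E).
  by apply/measurable_EFinP; exact: measurableT_comp.
have mnF2 : measurable_fun K (fun z => `|F2 z|%:E).
  by apply/measurable_EFinP; exact: measurableT_comp.
have mSE : measurable_fun K (EFin \o S) by exact/measurable_EFinP.
apply: (@le_trans _ _ (\int[volume]_(z in K) `|F1 z|%:E + \int[volume]_(z in K) `|F2 z|%:E)%E).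
  rewrite /volume; apply: leeD.
    rewrite (le_trans (lee_abs _))// abseN.
    by apply: (le_abse_integral _ mK); exact/measurable_EFinP.
  rewrite (le_trans (lee_abs _))//.
  by apply: (le_abse_integral _ mK); exact/measurable_EFinP.
rewrite /volume -ge0_integralD//.
rewrite -ge0_integralD//; last by move=> z _; rewrite lee_fin.
apply: ge0_le_integral => //.
- by move=> z _; rewrite adde_ge0.
- exact: emeasurable_funD.
- exact: emeasurable_funD.
move=> z Kz; have [tP rP] := KE Kz.
rewrite -!EFinD lee_fin.
have -> : `|F1 z| + `|F2 z| = `|u z| * `|eta1 l.+1 P z.1 * cutprofile h m l P (sqnorm z.2)| +
  `|u z| * `|eta l.+1 P z.1 * adjoint_defect k N%:R h h1 m l P (sqnorm z.2)|.
  by rewrite /F1 /F2 normrM; congr (_ + _); rewrite normrM normrN mulrC.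
apply: (le_trans (H _ _ (u z) tP rP)).
by rewrite lerD2r /S enorm_powR mulrAC.
Qed.

End fixed_scale.
End interior.

(** * Non-existence of weak solutions *)

Section core.
Context {R : realType} {N : nat}.

Lemma not_le_negative_power (a C e : R) : 0 < a -> e < 0 ->
  ~ (forall n, a <= C * (4 ^+ n) `^ e).
Proof.
move=> a0 e0 H.
have q0 : 0 < 4 `^ e :> R by exact: powR_gt0.
have q1 : 4 `^ e < 1 :> R.
  have := @gt0_ltr_powR R (- e) _ 1 4; rewrite oppr_gt0 !nnegrE powR1 powRN => /(_ e0).
  move=> /(_ ler01 (ler0n _ _)); rewrite invf_gt1// => -> //; lra.
have cq : C * (4 `^ e) ^+ n @[n --> \oo] --> C * 0.
  apply: cvgMr; apply: cvg_expr; first by rewrite ger0_norm// ltW.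
rewrite mulr0 in cq.
have [n _ /(_ n (leqnn n))] := @cvgr_lt R _ _ _ (fun n => C * (4 `^ e) ^+ n) 0 cq a a0.
by apply/negP; rewrite -leNgt -powR_mulrn ?powR_ge0// -powRrM [e * _]mulrC powRrM powR_mulrn.
Qed.

(** The tests at the scales P = 4^n contradict each other as n tends to infinity. *)
Lemma no_test_inequality (k sigma alpha p B c0 : R) (h h1 h2 : R -> R)
    (f : 'rV[R]_N -> R) (u : R * 'rV[R]_N -> R) :
  1 < p -> -1 <= alpha <= 0 -> profile k N%:R B h h1 h2 ->
  (2 * B + N%:R - 2) * (p - 1) < sigma + 2 * (alpha + 1) -> 0 < c0 ->
  (@sphere_measure R N).-integrable usphere (EFin \o f) ->
  (0 < \int[sphere_measure]_(x in usphere) (f x)%:E)%E ->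
  Lp_loc p u ->
  ~ (forall m l (P : R), 1 <= P ->
     (source alpha sigma p u (testfun h m l P) +
       (c0 * eta_mass l.+1 P)%:E * \int[sphere_measure]_(x in usphere) (f x)%:E <=
     adjoint k u (testfun h m l P))%E).
Proof.
move=> p1 /andP[al1 al0] hp crit c00 jf If0 hu H.
set s := (p - 1)^-1.
have p10 : 0 < p - 1 by rewrite subr_gt0.
have s0 : 0 < s by rewrite invr_gt0.
(* The first alternative is forced by the pointwise bound; the second keeps b + N/2 positive, and any constant in ]0, 1[ could replace 1/2. *)
pose b := Num.max (B - sigma / 2 / (p - 1)) (- (N%:R / 2) + 2^-1).
have Bb : B - sigma / 2 / (p - 1) <= b by rewrite le_max lexx.
have bN : 0 < b + N%:R / 2.
  have : - (N%:R / 2) + 2^-1 <= b by rewrite le_max lexx orbT.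
  by lra.
pose e := -1 - s - alpha * s + (b + N%:R / 2).
have e0 : e < 0.
  have sal : 0 <= s * (1 + alpha) by rewrite mulr_ge0 ?(ltW s0)//; lra.
  suff : b < 1 + s * (1 + alpha) - N%:R / 2 by rewrite /e; lra.
  rewrite gt_max; apply/andP; split; last by lra.
  rewrite -subr_gt0 -/s.
  rewrite [ltRHS](_ : _ = s / 2 * (sigma + 2 * (alpha + 1) - (2 * B + N%:R - 2) * (p - 1))).
    by rewrite mulr_gt0 ?divr_gt0// subr_gt0.
  by rewrite /s; field; exact: lt0r_neq0.
pose m := Num.bound `|b|.
have bm : 0 <= b + m.+1%:R * (1 + s).
  have mb : `|b| < m%:R by exact: archi_boundP.
  have : - `|b| <= b by rewrite lerNl -normrN ler_norm.
  have : m%:R <= m.+1%:R * (1 + s) :> R.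
    rewrite -[leLHS]mulr1; apply: ler_pM => //; first by rewrite ler_nat.
    by rewrite lerDl ltW.
  by lra.
pose l := Num.bound (2 * s).
have pl : l.+3%:R <= p * l.+1%:R.
  have lb : 2 * s < l%:R.
    by apply: archi_boundP; rewrite mulr_ge0// ltW.
  have : 2 <= (p - 1) * l.+1%:R.
    rewrite -ler_pdivrMl// -/s mulrC (le_trans (ltW lb))// ler_nat//.
  by rewrite -!natr1; lra.
have [C C0 test] := @test_inequality R p alpha sigma k N%:R B b h h1 h2 m l p1 al0 hp Bb bm pl.
have [C1 C10 annC1] := @annulus_integral R N b bN.
set I := (\int[sphere_measure]_(x in usphere) (f x)%:E)%E in If0 H.
have IE : I = (fine I)%:E by rewrite fineK//; exact: (integrable_fin_num measurable_usphere jf).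
have I0 : 0 < fine I by rewrite -lte_fin -IE.
pose D := 2 * C * (C1 * 4 `^ (b + N%:R / 2) + 2 ^+ N * 4 `^ (N%:R / 2)).
apply: (@not_le_negative_power (c0 * (3 / 4) ^+ l.+3 * fine I) D e _ e0).
  by apply: mulr_gt0 => //; apply: mulr_gt0 => //; rewrite exprn_gt0// divr_gt0.
move=> n; set P : R := 4 ^+ n.
have P1 : 1 <= P by rewrite exprn_ege1//; lra.
have P0 : 0 < P by exact: lt_le_trans P1.
have Hn := H m l P P1.
set E := P `^ (-1 - s - alpha * s).
have CE : 0 <= C * E by rewrite mulr_ge0 ?powR_ge0.
have adj := @adjoint_le R N k sigma alpha p B b h h1 h2 m l hp u hu P P1 (C * E) CE
  (fun t r v tP rP => test P t r v P1 tP rP).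
have rem := cylinder_remainder CE bN annC1 (erefl P).
have sfin : source alpha sigma p u (@testfun R N h m l P) \is a fin_num.
  rewrite ge0_fin_numE; first exact: (@source_lty R N k sigma alpha p B h h1 h2 m l hp u hu P P1 al0).
  apply: integral_ge0 => z [_]; rewrite enorm_ge1 => z1.
  rewrite lee_fin; apply: mulr_ge0; first by rewrite !mulr_ge0 ?powR_ge0.
  exact: (testfun_ge0 hp).
have := le_trans Hn (le_trans adj (leeD2l _ rem)).
rewrite leeD2lE// IE -EFinM lee_fin => fin.
rewrite -(ler_pM2r P0).
have -> : D * P `^ e * P = 2 * P * (C * E) *
   ((C1 * 4 `^ (b + N%:R / 2) + 2 ^+ N * 4 `^ (N%:R / 2)) * P `^ (b + N%:R / 2)).
  have -> : P `^ e = E * P `^ (b + N%:R / 2).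
    by rewrite /E -powRD// (gt_eqF P0) implybT.
  by rewrite /D; ring.
apply: le_trans fin.
have mg := @eta_mass_ge R l.+1 P P0.
rewrite [leLHS](_ : _ = c0 * ((3 / 4) ^+ l.+3 * P) * fine I); last by ring.
by rewrite ler_pM2r// ler_pM2l.
Qed.

End core.

Unset Implicit Arguments.
Set Strict Implicit.

Theorem theorem1p5 (R : realType) (N : nat) (hN : (2 <= N)%N)
    (k sigma alpha : R) (f : 'rV[R]_N -> R)
    (hf : (@sphere_measure R N).-integrable usphere (EFin \o f))
    (hIf : (0 < \int[sphere_measure]_(x in usphere) (f x)%:E)%E)
    (halpha : -1 <= alpha <= 0) (hk : k <= 2 - N%:R)
    (p : R) (hp : 1 < p) :
  (2 - N%:R - k < sigma + 2 * (alpha + 1) ->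
     ~ exists u : R * 'rV[R]_N -> R, weak_solution_Neumann k sigma alpha p f u)
  /\
  (0 < sigma + 2 * (alpha + 1) ->
     ~ exists u : R * 'rV[R]_N -> R, weak_solution_Dirichlet k sigma alpha p f u).
Proof.
have p10 : 0 < p - 1 by rewrite subr_gt0.
split=> crit [u [hu wu]].
  have prof := profile_Neumann k N%:R.
  have le0 : (2 * (k / 2) + N%:R - 2) * (p - 1) <= 0 by rewrite pmulr_lle0//; lra.
  have pos : 0 < sigma + 2 * (alpha + 1) by lra.
  apply: (no_test_inequality hp halpha prof (le_lt_trans le0 pos) ltr01 hf hIf hu).
  move=> m l P P1; have P0 : 0 < P by exact: lt_le_trans P1.
  have h1 : pow0 (k / 2) 1 = 1 :> R by rewrite /pow0 powR1.
  have G z : @Gamma R N z -> testfun (pow0 (k / 2)) m l P z = 1 * eta l.+1 P z.1.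
    by move=> [_ z1]; rewrite testfun_sphere// h1.
  rewrite -(boundary_integral P0 hf G); apply: wu; split.
  - exact: (C12_testfun prof).
  - by move=> z [_]; rewrite enorm_ge1; exact: (testfun_ge0 prof).
  - exact: compactly_supported_testfun.
  move=> z Gz; rewrite G// (dnu_testfun prof); last by case: Gz.
  by rewrite /pow1 powR1; field.
have main (B : R) (h h1 h2 : R -> R) : profile k N%:R B h h1 h2 ->
    (2 * B + N%:R - 2) * (p - 1) < sigma + 2 * (alpha + 1) ->
    h 1 = 0 -> 0 < h1 1 -> False.
  move=> prof cr h0 h10; have c0 : 0 < 2 * h1 1 by rewrite mulr_gt0.
  apply: (no_test_inequality hp halpha prof cr c0 hf hIf hu).
  move=> m l P P1; have P0 : 0 < P by exact: lt_le_trans P1.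
  have G z : @Gamma R N z -> dnu (testfun h m l P) z = - (2 * h1 1) * eta l.+1 P z.1.
    by move=> [_ z1]; rewrite (dnu_testfun prof).
  have -> : ((2 * h1 1 * eta_mass l.+1 P)%:E * \int[sphere_measure]_(x in usphere) (f x)%:E =
     - \int[lateral]_(z in Gamma) (f z.2 * dnu (testfun h m l P) z)%:E)%E.
    by rewrite (boundary_integral P0 hf G) mulNr EFinN mulNe oppeK.
  apply: wu; split.
  - exact: (C12_testfun prof).
  - by move=> z [_]; rewrite enorm_ge1; exact: (testfun_ge0 prof).
  - exact: compactly_supported_testfun.
  - by move=> z [_ z1]; rewrite testfun_sphere// h0 mul0r.
  move=> z Gz; rewrite G// mulNr oppr_le0 mulr_ge0 ?(ltW c0)//.
  exact: eta_ge0.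
have [kN|kN] := ltP k (2 - N%:R).
  apply: (main _ _ _ _ (profile_Dirichlet kN)).
  - by rewrite [ltLHS](_ : _ = 0)//; field.
  - by rewrite /pow0 !powR1 subrr.
  - by rewrite /pow1 !powR1; lra.
(* With B = 1 - N/2 + eps the criterion reads 2 eps (p - 1) < sigma + 2 (alpha + 1). *)
pose eps := (sigma + 2 * (alpha + 1)) / (4 * (p - 1)).
have eps0 : 0 < eps by rewrite /eps divr_gt0// mulr_gt0.
have kE : k = 2 - N%:R by apply/eqP; rewrite eq_le hk kN.
apply: (main _ _ _ _ (profile_Dirichlet_log kE eps0)).
- rewrite [ltLHS](_ : _ = (sigma + 2 * (alpha + 1)) / 2); first by lra.
  by rewrite /eps; field; exact: lt0r_neq0.
- by rewrite /powln ln1 mulr0.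
- by rewrite /powln1 ln1 mulr0 add0r powR1 mulr1.
Qed.
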